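(* Let $\Omega\subset\mathbb C^n$ be a convex domain containing no affine complex lines and assume that $\partial\Omega$ contains a non-Goldilocks line segment $S$. Then $\Omega$ is not Gromov hyperbolic (with respect to the Kobayashi distance $k_\Omega$).
   Context: $\Delta$ is the unit disc and $k_\Omega$ is the Kobayashi distance of $\Omega$; Gromov hyperbolicity of $\Omega$ means Gromov hyperbolicity of the metric space $(\Omega,k_\Omega)$. $\delta_\Omega(z)$ is the Euclidean distance from $z\in\Omega$ to $\partial\Omega$, and $\delta_\Omega(z;v):=\sup\{r>0: z+\alpha v\in\Omega \text{ for all }\alpha\in r\Delta\}$. Let $\Omega\subset\mathbb C^n$ be a convex domain containing no affine complex lines. A (nondegenerate) line segment $S\subset\partial\Omega$ is a non-Goldilocks line segment if: (1) there is a complex hyperplane $H\subset\mathbb C^n$ such that $S\subset H\cap\partial\Omega$; (2) there are $\delta_0>0$ and a unit vector $X\in\mathbb C^n$ such that for all $p\in S$ and $r\in(0,\delta_0)$, $p_r:=p+rX\in\Omega$ and $\delta_\Omega(p_r)=\|p-p_r\|=r$; (3) with $Y:=(s-q)/\|s-q\|$ for two distinct points $s,q\in S$, there is a function $H:(0,\delta_0)\to[0,\infty)$ such that $\delta_\Omega(p_r;Y)\ge H(r)$ for all $p\in S$ and $r\in(0,\delta_0)$, and $\int_0^{\delta_0}\frac{H(r)}{r}\,dr=\infty$. *)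

(* Defs.v *)
From HB Require Import structures.
From mathcomp Require Import all_boot all_order all_algebra.
From mathcomp Require Import complex.
From mathcomp Require Import all_classical all_reals all_analysis.

Set Implicit Arguments.
Unset Strict Implicit.
Unset Printing Implicit Defensive.

Import Order.TTheory GRing.Theory Num.Theory.
Import numFieldTopology.Exports numFieldNormedType.Exports.
Import ComplexField.Normc.

Local Open Scope classical_set_scope.
Local Open Scope ring_scope.
Local Open Scope complex_scope.

(** The library puts the norm topology only on abstract fields and on aliases
    [K^o]; here it is transferred to the concrete type [R[i]]. *)
HB.instance Definition _ (R : rcfType) := PseudoPointedMetric.copy R[i] R[i]^o.
HB.instance Definition _ (R : rcfType) := GRing.ComAlgebra.copy R[i] R[i]^o.
HB.instance Definition _ (R : rcfType) := Vector.copy R[i] R[i]^o.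
HB.instance Definition _ (R : rcfType) := NormedModule.copy R[i] R[i]^o.

(** C^n is ['rV[R[i]]_n] for [R : realType]. Its library norm is the sup norm,
    which gives the right topology but not the Euclidean distances. *)

Definition enorm (R : realType) (n : nat) (v : 'rV[R[i]]_n) : R :=
  Num.sqrt (\sum_(k < n) normc (v ord0 k) ^+ 2).

Definition boundary (T : topologicalType) (A : set T) : set T :=
  closure A `\` interior A.

(** [convex_set] is used over the scalars [R[i]]; in the partial order of
    [R[i]], the condition [0 <= t <= 1] forces [t] to be real, so this is
    ordinary real convexity. Convex sets being connected, an open nonempty
    convex set is a domain. *)
Definition convex_domain (R : realType) (n : nat) (Omega : set 'rV[R[i]]_n) :=
  [/\ open Omega, Omega !=set0 & convex_set Omega].

Definition contains_complex_line (R : realType) (n : nat)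
    (Omega : set 'rV[R[i]]_n) : Prop :=
  exists p v : 'rV[R[i]]_n, v != 0 /\ forall a : R[i], Omega (p + a *: v).

Definition unit_disc (R : realType) : set R[i] := [set a | normc a < 1].

Definition poincare_dist (R : realType) (a b : R[i]) : R :=
  let m := normc ((a - b) / (1 - a^*%C * b)) in 2^-1 * ln ((1 + m) / (1 - m)).

(** Holomorphic maps from the unit disc to [Omega]. The scalar field is [R[i]],
    so [derivable] is complex differentiability. The values of [phi] outside
    the disc are irrelevant. *)
Definition holomorphic_disc (R : realType) (n : nat) (Omega : set 'rV[R[i]]_n)
    (phi : R[i] -> 'rV[R[i]]_n) : Prop :=
  forall a : R[i], unit_disc a -> derivable phi a 1 /\ Omega (phi a).

(** [disc_chain Omega z w l]: some finite chain of holomorphic discs in [Omega]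
    joins [z] to [w] and has total Poincare length [l]. *)
Inductive disc_chain (R : realType) (n : nat) (Omega : set 'rV[R[i]]_n) :
    'rV[R[i]]_n -> 'rV[R[i]]_n -> R -> Prop :=
| disc_chain_nil z : Omega z -> disc_chain Omega z z 0
| disc_chain_cons (phi : R[i] -> 'rV[R[i]]_n) (a b : R[i]) w l :
    holomorphic_disc Omega phi -> unit_disc a -> unit_disc b ->
    disc_chain Omega (phi b) w l ->
    disc_chain Omega (phi a) w (poincare_dist a b + l).

Definition kobayashi_dist (R : realType) (n : nat) (Omega : set 'rV[R[i]]_n)
    (z w : 'rV[R[i]]_n) : R :=
  inf [set l | disc_chain Omega z w l].

Definition gromov_product (R : realType) (T : Type) (d : T -> T -> R)
    (o x y : T) : R :=
  2^-1 * (d x o + d y o - d x y).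

(** The four-point condition, meaningful on any (not necessarily geodesic)
    metric space. *)
Definition gromov_hyperbolic (R : realType) (T : Type) (X : set T)
    (d : T -> T -> R) : Prop :=
  exists delta : R, forall o x y z, X o -> X x -> X y -> X z ->
    Num.min (gromov_product d o x y) (gromov_product d o y z) - delta
      <= gromov_product d o x z.

(** Both distances are extended reals, so that an empty boundary or an
    unbounded supremum gives [+oo] rather than a default value. *)
Definition bdist (R : realType) (n : nat) (Omega : set 'rV[R[i]]_n)
    (z : 'rV[R[i]]_n) : \bar R :=
  ereal_inf [set (enorm (z - w))%:E | w in boundary Omega].

Definition bdist_dir (R : realType) (n : nat) (Omega : set 'rV[R[i]]_n)
    (z v : 'rV[R[i]]_n) : \bar R :=
  ereal_sup [set r%:E | r in [set r : R |
    0 < r /\ forall a : R[i], normc a < r -> Omega (z + a *: v)]].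

Definition segment (R : realType) (n : nat) (p q : 'rV[R[i]]_n) :
    set 'rV[R[i]]_n :=
  [set (1 - t)%:C *: p + t%:C *: q | t in `[0 : R, 1]].

Definition line_segment (R : realType) (n : nat) (S : set 'rV[R[i]]_n) : Prop :=
  exists p q, p != q /\ S = segment p q.

(** Affine hyperplanes, not necessarily through the origin. *)
Definition complex_hyperplane (R : realType) (n : nat)
    (H : set 'rV[R[i]]_n) : Prop :=
  exists (a : 'rV[R[i]]_n) (c : R[i]),
    a != 0 /\ H = [set z | \sum_(k < n) a ord0 k * z ord0 k = c].

(** [Y] is determined by [S] up to sign, and [bdist_dir Omega z] is even, so the
    choice of [s] and [q] is immaterial. Only the values of [H] on [(0, delta0)]
    matter; measurability there is what makes its Lebesgue integral meaningful. *)
Definition non_goldilocks_segment (R : realType) (n : nat)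
    (Omega S : set 'rV[R[i]]_n) : Prop :=
  [/\ line_segment S,
      S `<=` boundary Omega,
      exists H, complex_hyperplane H /\ S `<=` H `&` boundary Omega
    & exists (delta0 : R) (X : 'rV[R[i]]_n),
      [/\ 0 < delta0,
          enorm X = 1,
          forall p (r : R), S p -> 0 < r < delta0 ->
            let pr := p + r%:C *: X in
            [/\ Omega pr, bdist Omega pr = (enorm (p - pr))%:E
              & enorm (p - pr) = r]
        & exists s q, [/\ S s, S q, s != q &
          let Y := (enorm (s - q))^-1%:C *: (s - q) in
          exists H : R -> R,
            [/\ measurable_fun `]0, delta0[ H,
                forall r : R, 0 < r < delta0 -> 0 <= H r,
                forall p (r : R), S p -> 0 < r < delta0 ->
                  ((H r)%:E <= bdist_dir Omega (p + r%:C *: X) Y)%E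
              & (\int[lebesgue_measure]_(r in `]0%R, delta0[) (H r / r)%:E
                  = +oo)%E]]]].

(* Main.v *)
(** If [Omega] is Gromov hyperbolic, write [m_r = m + r X] for [m] in [S].  As
    [Omega] contains the balls of radius [r] about [m_r], it lies in the
    half-space [Re <z - m, X> > 0], and the Schwarz-Pick inequality shows that
    [r |-> m_r], parametrized by [- ln r / 2], is a geodesic ray up to an
    additive constant.  As the integral of [H r / r] diverges, a path descending
    at unit speed towards the boundary can move by [H] at each level and so pass
    from one end of [S] to the other, starting at any height; its consecutive
    Gromov products grow linearly, so the rays over two points [p], [q] of [S] are
    asymptotic and the distance of [p_r] and [q_r] stays bounded as [r -> 0].
    This forces a whole complex disc about [p] in the direction [Y] to lie in
    the boundary.

    The complex line through [S] is not contained in the closure of [Omega], so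
    the face containing this disc has a boundary point [p + b Y].  For
    [0 < lam < 1] the rays over [p] and over [p + lam b Y] are asymptotic, and
    hyperbolicity bounds their eventual distance independently of [lam], whereas
    a supporting half-space near [p + b Y] makes this distance at least about
    [- ln (1 - lam) / 2].

    The Schwarz-Pick inequality is derived from Goursat's lemma, applied to
    [G (exp s)] on rectangles of height [2 pi]. *)

Require Import Defs.
From HB Require Import structures.
From mathcomp Require Import all_boot all_order all_algebra.
From mathcomp Require Import complex ring lra.
From mathcomp Require Import all_classical all_reals all_analysis measurable_realfun.

Set Implicit Arguments.
Unset Strict Implicit.
Unset Printing Implicit Defensive.

Import Order.TTheory GRing.Theory Num.Theory.
Import numFieldTopology.Exports numFieldNormedType.Exports.
Import ComplexField.Normc.

Local Open Scope classical_set_scope.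
Local Open Scope ring_scope.
Local Open Scope complex_scope.

(** * Goursat's lemma *)

(** Upper bounds on the Kobayashi distance come from affine discs, lower bounds from a
    complex-linear form [a] with [0 < Re (lform a (u - p))] on [Omega]: along a chain of discs
    [ln |lform a (u - p)|] changes by at most twice the length. The form given by [X] measures
    height, and divergence of the integral forces it to vanish on [Y], so drifting along the segment
    keeps the height. A form centred at a point off the closure compares two points of a complex
    line through it by their distances to that point.

    Closeness of rays comes in two grades. The drifting path bounds the distance over the two ends
    of the segment, which yields a disc in the boundary but says nothing about rays outside the
    segment. For the ray over [P + lam b Y], convexity and the disc supply affine discs whose radius
    depends on [lam] but not on the height, hence some bound depending on [lam]; two uses of the
    four-point inequality replace it by a constant made of the hyperbolicity constant and the
    additive error of the rays. Only then can [lam] be taken so close to 1 that the lower bound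
    exceeds it. *)

Section goursat.
Context {R : realType}.
Implicit Types (f g : R -> R) (u v : R -> R -> R) (a b c d e x y w h k l : R).

Lemma mean_value f g a b : a < b ->
  (forall x, a <= x <= b -> is_derive x 1 f (g x)) ->
  exists2 x, a <= x <= b & f b - f a = g x * (b - a).
Proof.
move=> ab fg; have [||x] := @MVT R f g a b ab.
- by move=> x; rewrite in_itv/= => /andP[ax xb]; apply: fg; rewrite !ltW.
- apply: derivable_within_continuous => x; rewrite in_itv/= => xab.
  by have [] := fg x xab.
by rewrite in_itv/= => /andP[ax xb] E; exists x; rewrite ?(ltW ax) ?ltW.
Qed.

Lemma derive_bound f g a b c e : a < b ->
  (forall x, a <= x <= b -> is_derive x 1 f (g x)) ->
  (forall x, a <= x <= b -> `|g x - c| <= e) ->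
  `|f b - f a - c * (b - a)| <= e * (b - a).
Proof.
move=> ab fg gc; have [x xab ->] := mean_value ab fg.
rewrite -mulrBl normrM (ger0_norm (_ : 0 <= b - a)) ?subr_ge0 ?(ltW ab)//.
by apply: ler_wpM2r; rewrite ?subr_ge0 ?(ltW ab)// gc.
Qed.

Lemma antiderivative f a b :
  (forall x, a <= x <= b -> {for x, continuous f}) ->
  exists U : R -> R, forall x, a < x < b -> is_derive x 1 U (f x).
Proof.
move=> cf; exists (fun x => \int[lebesgue_measure]_(t in `[a, x]) f t).
move=> x /andP[ax xb].
have fi : lebesgue_measure.-integrable `[a, b] (EFin \o f).
  apply: continuous_compact_integrable; first exact: segment_compact.
  apply: continuous_in_subspaceT => y.
  by rewrite inE/= in_itv/= => yab; apply: cf.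
have [|dF F'] := @continuous_FTC1_closed R f a x b xb fi ax.
  by apply: cf; rewrite !ltW.
by apply: DeriveDef; [exact: dF|rewrite -derive1E].
Qed.

Lemma nested_intervals (x l : nat -> R) :
  (forall n, x n <= x n.+1) -> (forall n, x n.+1 + l n.+1 <= x n + l n) ->
  (forall n, 0 <= l n) ->
  exists c, forall n, x n <= c <= x n + l n.
Proof.
move=> incx decx l0.
have mono m n : (m <= n)%N -> x m <= x n /\ x n + l n <= x m + l m.
  elim: n => [|n IH]; first by rewrite leqn0 => /eqP ->.
  rewrite leq_eqVlt => /orP[/eqP->//|/IH[h1 h2]]; split.
    exact: le_trans h1 (incx _).
  exact: le_trans (decx _) h2.
have bnd m n : x m <= x n + l n.
  have [mn|/ltnW nm] := leqP m n.
    by apply: le_trans (mono _ _ mn).1 _; rewrite lerDl.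
  by apply: le_trans (mono _ _ nm).2; rewrite lerDl.
have hs : has_sup (range x).
  split; first by exists (x 0%N); exists 0%N.
  by exists (x 0%N + l 0%N) => _ [m _ <-].
exists (sup (range x)) => n; apply/andP; split.
  by apply: ub_le_sup; [exact: hs.2|exists n].
by apply: ge_sup; [exact: hs.1|move=> _ [m _ <-]].
Qed.

Lemma small_halving (w d : R) : 0 < d -> exists n : nat, w / 2 ^+ n < d.
Proof.
move=> d0; exists (Num.truncn `|w / d|).+1.
rewrite ltr_pdivrMr ?exprn_gt0// mulrC -ltr_pdivrMr//.
apply: le_lt_trans (ler_norm _) _.
apply: lt_trans (truncnS_gt _) _.
by rewrite -natrX ltr_nat ltn_expl.
Qed.

(** [u + i v] has complex derivative [l1 + i l2] at [x + i y]. *)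
Definition diff2 u v x y (l1 l2 : R) := forall e, 0 < e -> exists2 d : R, 0 < d &
  forall h k, `|h| < d -> `|k| < d ->
    `|u (x + h) (y + k) - u x y - (l1 * h - l2 * k)| <= e * (`|h| + `|k|) /\
    `|v (x + h) (y + k) - v x y - (l2 * h + l1 * k)| <= e * (`|h| + `|k|).

Variables (u v : R -> R -> R) (a b c d : R) (A B : R -> R -> R).
Hypothesis dF : forall x y, a < x < b -> c < y < d -> exists l1 l2, diff2 u v x y l1 l2.
Hypothesis dA : forall x y, a < x < b -> c < y < d ->
  is_derive x 1 (A y) (u x y).
Hypothesis dB : forall x y, a < x < b -> c < y < d ->
  is_derive y 1 (B x) (v x y).

(** With [A y] and [B x] antiderivatives of [u] along horizontals and of [v]
    along verticals, the real part of the integral of [u + i v] around a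
    rectangle. *)
Let Phi x y w h := (A y (x + w) - A y x) - (A (y + h) (x + w) - A (y + h) x)
  - ((B (x + w) (y + h) - B (x + w) y) - (B x (y + h) - B x y)).

Lemma rectangle_quarter x y w h k : k <= `|Phi x y w h| ->
  exists p : R * R, [/\ p.1 = x \/ p.1 = x + w / 2, p.2 = y \/ p.2 = y + h / 2
    & k / 4 <= `|Phi p.1 p.2 (w / 2) (h / 2)|].
Proof.
move=> kP.
have E : Phi x y w h = Phi x y (w / 2) (h / 2) + Phi (x + w / 2) y (w / 2) (h / 2)
   + Phi x (y + h / 2) (w / 2) (h / 2) + Phi (x + w / 2) (y + h / 2) (w / 2) (h / 2).
  rewrite /Phi -!addrA -!splitr.
  set t1 := x + w / 2; set t2 := y + h / 2.
  ring.
have [h1|h1] := lerP (k / 4) `|Phi x y (w / 2) (h / 2)|.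
  by exists (x, y); split => //=; left.
have [h2|h2] := lerP (k / 4) `|Phi (x + w / 2) y (w / 2) (h / 2)|.
  by exists (x + w / 2, y); split => //=; [right|left].
have [h3|h3] := lerP (k / 4) `|Phi x (y + h / 2) (w / 2) (h / 2)|.
  by exists (x, y + h / 2); split => //=; [left|right].
have [h4|h4] := lerP (k / 4) `|Phi (x + w / 2) (y + h / 2) (w / 2) (h / 2)|.
  by exists (x + w / 2, y + h / 2); split => //=; right.
exfalso; move: kP; rewrite E leNgt => /negP; apply.
apply: le_lt_trans (ler_normD _ _) _.
apply: le_lt_trans (lerD (ler_normD _ _) (lexx _)) _.
apply: le_lt_trans (lerD (lerD (ler_normD _ _) (lexx _)) (lexx _)) _.
lra.
Qed.

(** Opposite sides are paired. By the Cauchy-Riemann equations built into [diff2], the affine part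
    contributes [l2 * h * w] on the horizontal pair and [l2 * w * h] with the opposite sign on the
    vertical pair, so only the errors [e] remain. *)
Lemma rectangle_small x y w h xs ys l1 l2 e : 0 < w -> 0 < h ->
  a < x -> x + w < b -> c < y -> y + h < d -> 
  (forall x' y', x <= x' <= x + w -> y <= y' <= y + h ->
    `|u x' y' - u xs ys - (l1 * (x' - xs) - l2 * (y' - ys))| <= e /\
    `|v x' y' - v xs ys - (l2 * (x' - xs) + l1 * (y' - ys))| <= e) ->
  `|Phi x y w h| <= 2 * e * (w + h).
Proof.
move=> w0 h0 ax xb cy yd uv.
have xxw : x < x + w by rewrite ltrDl.
have yyh : y < y + h by rewrite ltrDl.
have hA : `|(A y (x + w) - A (y + h) (x + w)) - (A y x - A (y + h) x) - l2 * h * (x + w - x)|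
    <= 2 * e * (x + w - x).
  apply: (@derive_bound (fun t => A y t - A (y + h) t) (fun t => u t y - u t (y + h))) => //.
    move=> t /andP[xt tx]; apply: is_deriveB; apply: dA; lra.
  move=> t txw.
  have [h1 _] : _ /\ _ := uv t y txw ltac:(lra).
  have [h2 _] : _ /\ _ := uv t (y + h) txw ltac:(lra).
  move: h1 h2; rewrite !ler_norml; lra.
have hB : `|(B (x + w) (y + h) - B x (y + h)) - (B (x + w) y - B x y) - l2 * w * (y + h - y)|
    <= 2 * e * (y + h - y).
  apply: (@derive_bound (fun t => B (x + w) t - B x t) (fun t => v (x + w) t - v x t)) => //.
    move=> t /andP[xt tx]; apply: is_deriveB; apply: dB; lra.
  move=> t txw.
  have [_ h1] : _ /\ _ := uv x t ltac:(lra) txw.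
  have [_ h2] : _ /\ _ := uv (x + w) t ltac:(lra) txw.
  move: h1 h2; rewrite !ler_norml; lra.
move: hA hB; rewrite /Phi; set D1 := `|_|; set D2 := `|_| => hA hB.
have -> : 2 * e * (w + h) = 2 * e * (x + w - x) + 2 * e * (y + h - y) by ring.
apply: le_trans (lerD hA hB).
rewrite /D1 /D2; apply: le_trans (ler_normB _ _); rewrite le_eqVlt; apply/orP; left.
by apply/eqP; congr (`| _ |); ring.
Qed.

Lemma goursat x0 y0 W H : 0 < W -> 0 < H ->
  a < x0 -> x0 + W < b -> c < y0 -> y0 + H < d -> Phi x0 y0 W H = 0.
Proof.
move=> W0 H0 ax xb cy yd; apply/eqP; apply: contraT => Phi0.
set k := `|Phi x0 y0 W H|.
have k0 : 0 < k by rewrite normr_gt0.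
pose w n : R := W / 2 ^+ n; pose h n : R := H / 2 ^+ n.
have wS n : w n.+1 = w n / 2 by rewrite /w exprS invfM; ring.
have hS n : h n.+1 = h n / 2 by rewrite /h exprS invfM; ring.
have w0 n : 0 < w n by rewrite divr_gt0// exprn_gt0.
have h0 n : 0 < h n by rewrite divr_gt0// exprn_gt0.
have step (np : nat * (R * R)) : exists p : R * R,
    k / 4 ^+ np.1 <= `|Phi np.2.1 np.2.2 (w np.1) (h np.1)| ->
    [/\ p.1 = np.2.1 \/ p.1 = np.2.1 + w np.1.+1, p.2 = np.2.2 \/ p.2 = np.2.2 + h np.1.+1
      & k / 4 ^+ np.1.+1 <= `|Phi p.1 p.2 (w np.1.+1) (h np.1.+1)|].
  case: np => n [x y] /=.
  have [hk|] := pselect (k / 4 ^+ n <= `|Phi x y (w n) (h n)|); last by exists (0, 0).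
  have [p [p1 p2 p3]] := rectangle_quarter hk.
  exists p => _; rewrite wS hS; split => //.
  by apply: le_trans p3; rewrite exprS invfM mulrA mulrAC.
have [F FP] := choice step.
pose s := fix s n : R * R := if n is m.+1 then F (m, s m) else (x0, y0).
have sP n : k / 4 ^+ n <= `|Phi (s n).1 (s n).2 (w n) (h n)|.
  elim: n => [|n IH]; first by rewrite /w /h !expr0 !divr1.
  by have [_ _] := FP (n, s n) IH.
have s1 n : (s n).1 <= (s n.+1).1 /\ (s n.+1).1 + w n.+1 <= (s n).1 + w n.
  have [+ _ _] := FP (n, s n) (sP n); move: (w0 n) => /=.
  by rewrite wS => ? [->|->]; split; lra.
have s2 n : (s n).2 <= (s n.+1).2 /\ (s n.+1).2 + h n.+1 <= (s n).2 + h n.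
  have [_ + _] := FP (n, s n) (sP n); move: (h0 n) => /=.
  by rewrite hS => ? [->|->]; split; lra.
have [xs xsP] := nested_intervals (fun n => (s1 n).1) (fun n => (s1 n).2) (fun n => ltW (w0 n)).
have [ys ysP] := nested_intervals (fun n => (s2 n).1) (fun n => (s2 n).2) (fun n => ltW (h0 n)).
have b1 n : x0 <= (s n).1 /\ (s n).1 + w n <= x0 + W.
  elim: n => [|n [i1 i2]]; first by rewrite /w expr0 divr1.
  by split; [exact: le_trans i1 (s1 n).1|exact: le_trans (s1 n).2 i2].
have b2 n : y0 <= (s n).2 /\ (s n).2 + h n <= y0 + H.
  elim: n => [|n [i1 i2]]; first by rewrite /h expr0 divr1.
  by split; [exact: le_trans i1 (s2 n).1|exact: le_trans (s2 n).2 i2].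
have xsab : a < xs < b.
  by move: (xsP 0%N) (b1 0%N) => /= /andP[? ?] [? ?]; lra.
have ysab : c < ys < d.
  by move: (ysP 0%N) (b2 0%N) => /= /andP[? ?] [? ?]; lra.
have [l1 [l2 D]] := dF xsab ysab.
(* With this constant the bound of [rectangle_small] on the rectangle of level [n1] is exactly half
   of the lower bound [k / 4 ^+ n1]. *)
pose e := k / (4 * (W + H) ^+ 2).
have WH : 0 < W + H by rewrite addr_gt0.
have e0 : 0 < e by rewrite divr_gt0// mulr_gt0// exprn_gt0.
have [dl dl0 D'] := D e e0.
have [n1 n1P] := small_halving (W + H) dl0.
have wh : w n1 + h n1 < dl by rewrite /w /h -mulrDl.
have small := @rectangle_small (s n1).1 (s n1).2 (w n1) (h n1) xs ys l1 l2
  (e * (w n1 + h n1)) (w0 _) (h0 _) (lt_le_trans ax (b1 n1).1)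
  (le_lt_trans (b1 n1).2 xb) (lt_le_trans cy (b2 n1).1) (le_lt_trans (b2 n1).2 yd).
have wn := w0 n1; have hn := h0 n1; have xsn := xsP n1; have ysn := ysP n1.
have {small}small := le_trans (sP n1) (small _).
suff : k / 4 ^+ n1 <= 2 * (e * (w n1 + h n1)) * (w n1 + h n1).
  have -> : 2 * (e * (w n1 + h n1)) * (w n1 + h n1) = k / 4 ^+ n1 / 2.
    rewrite /w /h -mulrDl /e.
    have -> : 4 ^+ n1 = (2 ^+ n1) ^+ 2 :> R by rewrite exprAC; congr (_ ^+ _); ring.
    field.
    by rewrite !gt_eqF// exprn_gt0.
  have : 0 < k / 4 ^+ n1 by rewrite divr_gt0// exprn_gt0.
  lra.
apply: small => x' y' hx hy.
have dx : `|x' - xs| <= w n1 by rewrite ler_norml; lra.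
have dy : `|y' - ys| <= h n1 by rewrite ler_norml; lra.
have [D1 D2] := D' (x' - xs) (y' - ys) (ltac:(lra)) (ltac:(lra)).
rewrite !(addrC xs) !(addrC ys) !subrK in D1 D2.
have ee : e * (`|x' - xs| + `|y' - ys|) <= e * (w n1 + h n1) by rewrite ler_pM2l// lerD.
by split; [exact: le_trans D1 ee|exact: le_trans D2 ee].
Qed.

End goursat.

(** * Complex differentiation *)

Section complex_calculus.
Context {R : realType}.
Implicit Types (x y r e d : R) (z w l : R[i]) (h k q : R[i] -> R[i]).

Lemma normc_ge0 z : 0 <= normc z.
Proof. by case: z => x y; rewrite /= sqrtr_ge0. Qed.

Lemma normc_eq0 z : (normc z == 0) = (z == 0).
Proof. by apply/eqP/eqP => [/eq0_normc//|->]; rewrite normc0. Qed.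

Lemma normc_gt0 z : (0 < normc z) = (z != 0).
Proof. by rewrite lt0r normc_eq0 normc_ge0 andbT. Qed.

Lemma normc_sqr z : normc z ^+ 2 = complex.Re z ^+ 2 + complex.Im z ^+ 2.
Proof. by case: z => x y; rewrite sqr_sqrtr// addr_ge0// sqr_ge0. Qed.

Lemma normcR x : normc x%:C = `|x|.
Proof. by rewrite /= expr0n/= addr0 sqrtr_sqr. Qed.

Lemma normc_Re z : `|complex.Re z| <= normc z.
Proof.
rewrite -(@ler_pXn2r _ 2) ?nnegrE ?normc_ge0//.
by rewrite normc_sqr -normrX ger0_norm ?sqr_ge0// lerDl sqr_ge0.
Qed.

Lemma normc_Im z : `|complex.Im z| <= normc z.
Proof.
rewrite -(@ler_pXn2r _ 2) ?nnegrE ?normc_ge0//.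
by rewrite normc_sqr -normrX ger0_norm ?sqr_ge0// lerDr sqr_ge0.
Qed.

Lemma normc_ReIm z : normc z <= `|complex.Re z| + `|complex.Im z|.
Proof.
case: z => x y; rewrite -(@ler_pXn2r _ 2) ?nnegrE ?normc_ge0 ?addr_ge0//.
rewrite normc_sqr/= sqrrD -[x ^+ 2]ger0_norm ?sqr_ge0// -[y ^+ 2]ger0_norm ?sqr_ge0//.
by rewrite !normrX lerD2r lerDl mulrn_wge0// mulr_ge0.
Qed.

Lemma normc_conj z : normc (z^*%C) = normc z.
Proof. by case: z => x y; rewrite /= sqrrN. Qed.

Lemma mulcJ z : z * z^*%C = (normc z ^+ 2)%:C.
Proof.
by rewrite normc_sqr; case: z => x y; apply/eqP; rewrite eq_complex/=;
  apply/andP; split; apply/eqP; ring.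
Qed.

Lemma conjcM z w : (z * w)^*%C = z^*%C * w^*%C.
Proof. exact: rmorphM. Qed.

Lemma conjcN z : (- z)^*%C = - z^*%C.
Proof. exact: rmorphN. Qed.

Lemma realCM x y : (x * y)%:C = x%:C * y%:C :> R[i].
Proof. exact: rmorphM. Qed.

Lemma realCX x n : (x ^+ n)%:C = x%:C ^+ n :> R[i].
Proof. exact: rmorphXn. Qed.

Lemma realCD x y : (x + y)%:C = x%:C + y%:C :> R[i].
Proof. exact: rmorphD. Qed.

Lemma realCB x y : (x - y)%:C = x%:C - y%:C :> R[i].
Proof. exact: rmorphB. Qed.

Lemma realCN x : (- x)%:C = - x%:C :> R[i].
Proof. exact: rmorphN. Qed.

Lemma realCV x : (x^-1)%:C = (x%:C)^-1 :> R[i].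
Proof. exact: fmorphV. Qed.

Lemma normcB z w : normc (z - w) = normc (w - z).
Proof. by rewrite -normcN opprB. Qed.

Lemma le_normcB z w : normc z - normc w <= normc (z - w).
Proof. by rewrite lerBlDr; apply: le_trans (le_normcD _ _); rewrite subrK. Qed.

Lemma complex_eqP z w :
  complex.Re z = complex.Re w -> complex.Im z = complex.Im w -> z = w.
Proof. by case: z w => [x y] [u v] /= -> ->. Qed.

(** The limit is taken over a full neighbourhood of 0, so it includes [q 0 = l]: the slope functions
    below are given the derivative as their value at 0. *)
Definition clim q l := forall e, 0 < e -> exists2 d : R, 0 < d &
  forall w, normc w < d -> normc (q w - l) < e.

Lemma clim_cst l : clim (fun=> l) l.
Proof. by move=> e e0; exists 1 => // w _; rewrite subrr normc0. Qed.

Lemma clim_id : clim id 0.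
Proof. by move=> e e0; exists e => // w; rewrite subr0. Qed.

Lemma climD q1 q2 l1 l2 : clim q1 l1 -> clim q2 l2 ->
  clim (fun w => q1 w + q2 w) (l1 + l2).
Proof.
move=> h1 h2 e e0; have e2 : 0 < e / 2 by rewrite divr_gt0.
have [d1 d10 H1] := h1 _ e2; have [d2 d20 H2] := h2 _ e2.
exists (Num.min d1 d2); first by rewrite lt_min d10.
move=> w; rewrite lt_min => /andP[w1 w2].
rewrite opprD addrACA; apply: le_lt_trans (le_normcD _ _) _.
by rewrite (splitr e) ltrD// (H1, H2).
Qed.

Lemma climM0 q1 q2 l1 : clim q1 l1 -> clim q2 0 -> clim (fun w => q1 w * q2 w) 0.
Proof.
move=> h1 h2 e e0.
have [d1 d10 H1] := h1 1 ltr01.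
have n0 : 0 < 1 + normc l1 by rewrite ltr_wpDr// normc_ge0.
have [|d2 d20 H2] := h2 (e / (1 + normc l1)); first by rewrite divr_gt0.
exists (Num.min d1 d2); first by rewrite lt_min d10.
move=> w; rewrite lt_min => /andP[/H1 w1 /H2]; rewrite !subr0 normcM => w2.
have {}w1 : normc (q1 w) < 1 + normc l1.
  by rewrite -(subrK l1 (q1 w)); apply: le_lt_trans (le_normcD _ _) _; rewrite ltrD2r.
have [->|q20] := eqVneq (normc (q2 w)) 0; first by rewrite mulr0.
apply: lt_trans (_ : (1 + normc l1) * normc (q2 w) < e).
  by rewrite ltr_pM2r// lt0r q20 normc_ge0.
by rewrite mulrC -ltr_pdivlMr.
Qed.

Lemma clim_sub q l : clim (fun w => q w - l) 0 <-> clim q l.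
Proof.
by split => H e /H[d d0 D]; exists d => // w /D; rewrite ?subr0.
Qed.

Lemma climM q1 q2 l1 l2 : clim q1 l1 -> clim q2 l2 ->
  clim (fun w => q1 w * q2 w) (l1 * l2).
Proof.
move=> h1 h2; apply/clim_sub.
have -> : (fun w => q1 w * q2 w - l1 * l2) =
   (fun w => q1 w * (q2 w - l2) + l2 * (q1 w - l1)) by apply/funext => w; ring.
rewrite -[0]addr0; apply: climD.
  by apply: climM0 h1 _; apply/clim_sub.
by apply: climM0 (clim_cst l2) _; apply/clim_sub.
Qed.

Lemma clim_comp q s : clim s 0 -> clim q (q 0) -> clim (fun w => q (s w)) (q 0).
Proof.
move=> h1 h2 e /h2[d d0 D]; have [d1 d10 D1] := h1 d d0.
by exists d1 => // w /D1; rewrite subr0 => /D.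
Qed.

Lemma clim_near q1 q2 l : (exists2 d : R, 0 < d & forall w, normc w < d -> q1 w = q2 w) ->
  clim q1 l -> clim q2 l.
Proof.
move=> [d d0 D] h1 e /h1[d1 d10 D1]; exists (Num.min d d1); first by rewrite lt_min d0.
by move=> w; rewrite lt_min => /andP[w1 w2]; rewrite -D// D1.
Qed.

Lemma clim_inv z : z != 0 -> clim (fun w => (z + w)^-1) z^-1.
Proof.
move=> z0 e e0; have nz : 0 < normc z by rewrite normc_gt0.
exists (Num.min (normc z / 2) (e * normc z ^+ 2 / 2)).
  by rewrite lt_min !divr_gt0// mulr_gt0// exprn_gt0.
move=> w; rewrite lt_min => /andP[w1 w2].
have zw : normc z / 2 < normc (z + w).
  have := le_normcB z (- w); rewrite opprK normcN => h; apply: lt_le_trans h.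
  by rewrite ltrBrDl -ltrBrDr; apply: lt_le_trans w1 _; rewrite lerBrDr -splitr.
have zw0 : z + w != 0.
  by rewrite -normc_gt0; apply: lt_trans zw; rewrite divr_gt0.
have -> : (z + w)^-1 - z^-1 = - w / ((z + w) * z) by field; rewrite z0 zw0.
rewrite normcM normcN normcV normcM ltr_pdivrMr ?mulr_gt0 ?normc_gt0//.
apply: lt_trans w2 _; have -> : e * normc z ^+ 2 / 2 = e * (normc z / 2 * normc z) by ring.
by rewrite ltr_pM2l// ltr_pM2r.
Qed.

Lemma clim_fix q1 q2 l : clim q1 l -> (forall w, w != 0 -> q2 w = q1 w) -> q2 0 = l ->
  clim q2 l.
Proof.
move=> c1 q12 q20 e /c1[d d0 D]; exists d => // w /D.
by have [->|/q12->//] := eqVneq w 0; rewrite q20 subrr normc0 => /(le_lt_trans (normc_ge0 _)).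
Qed.

(** Carathéodory's form of [h' z = l]. *)
Definition cdiff h z l :=
  exists2 q, clim q l & forall w, h (z + w) = h z + q w * w.

Lemma cdiff_cst c z : cdiff (fun=> c) z 0.
Proof. by exists (fun=> 0); [exact: clim_cst|move=> w; rewrite mul0r addr0]. Qed.

Lemma cdiff_id z : cdiff id z 1.
Proof. by exists (fun=> 1); [exact: clim_cst|move=> w; rewrite mul1r]. Qed.

Lemma cdiffD h k z l m : cdiff h z l -> cdiff k z m ->
  cdiff (fun w => h w + k w) z (l + m).
Proof.
move=> [q1 c1 H1] [q2 c2 H2]; exists (fun w => q1 w + q2 w); first exact: climD.
by move=> w; rewrite H1 H2; ring.
Qed.

Lemma clim_cdiff h z l : cdiff h z l -> clim (fun w => h (z + w)) (h z).
Proof.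
move=> [q c H]; apply/clim_sub.
have -> : (fun w => h (z + w) - h z) = (fun w => q w * w).
  by apply/funext => w; rewrite H; ring.
exact: climM0 c clim_id.
Qed.

Lemma cdiffM h k z l m : cdiff h z l -> cdiff k z m ->
  cdiff (fun w => h w * k w) z (l * k z + h z * m).
Proof.
move=> hl km; have := clim_cdiff km; case: hl km => [q1 c1 H1] [q2 c2 H2] ck.
exists (fun w => q1 w * k (z + w) + h z * q2 w).
  apply: climD; apply: climM => //; exact: clim_cst.
by move=> w; rewrite H1 H2; ring.
Qed.

Lemma cdiffMl c h z l : cdiff h z l -> cdiff (fun w => c * h w) z (c * l).
Proof. by move=> hl; have := cdiffM (cdiff_cst c z) hl; rewrite mul0r add0r. Qed.

Lemma cdiff_comp h k z l m : cdiff k z m -> cdiff h (k z) l ->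
  cdiff (fun w => h (k w)) z (l * m).
Proof.
move=> [q2 c2 H2] [q1 c1 H1].
pose q1' w := if w == 0 then l else q1 w.
exists (fun w => q1' (q2 w * w) * q2 w).
  apply: climM => //; rewrite (_ : l = q1' 0); last by rewrite /q1' eqxx.
  apply: clim_comp; first exact: climM0 c2 clim_id.
  rewrite [X in clim _ X]/q1' eqxx; apply: clim_fix c1 _ _; rewrite /q1' ?eqxx//.
  by move=> w /negPf ->.
move=> w; rewrite H2 H1 /q1'; case: (eqVneq (q2 w * w) 0) => [E|_]; last ring.
by rewrite -mulrA E; ring.
Qed.

Lemma cdiffV z : z != 0 -> cdiff (fun w => w^-1) z (- z ^- 2).
Proof.
(* At [w = - z] the convention [0^-1 = 0] makes the slope [(0 - z^-1) / (- z) = z ^- 2]. *)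
move=> z0; exists (fun w => if z + w == 0 then z ^- 2 else - z^-1 * (z + w)^-1).
  apply: (@clim_near (fun w => - z^-1 * (z + w)^-1)).
    exists (normc z); first by rewrite normc_gt0.
    move=> w wz; case: (eqVneq (z + w) 0) => // /eqP; rewrite addr_eq0 => /eqP E.
    by move: wz; rewrite E normcN ltxx.
  rewrite (_ : - z ^- 2 = - z^-1 * z^-1); last by field.
  by apply: climM; [exact: clim_cst|exact: clim_inv].
move=> w; case: (eqVneq (z + w) 0) => [E|E]; last by field; rewrite z0 E.
have -> : w = - z by apply/eqP; rewrite -addr_eq0 addrC E.
by rewrite subrr invr0; field.
Qed.

Lemma cdiff_eps h z l : cdiff h z l -> forall e, 0 < e -> exists2 d : R, 0 < d &
  forall w, normc w < d -> normc (h (z + w) - h z - l * w) <= e * normc w.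
Proof.
move=> [q c H] e /c[d d0 D]; exists d => // w /D wd.
rewrite H (_ : _ - _ - _ = (q w - l) * w); last by ring.
by rewrite normcM ler_wpM2r ?normc_ge0// ltW.
Qed.

Lemma eps_cdiff h z l : (forall e, 0 < e -> exists2 d : R, 0 < d &
  forall w, normc w < d -> normc (h (z + w) - h z - l * w) <= e * normc w) ->
  cdiff h z l.
Proof.
move=> H; exists (fun w => if w == 0 then l else (h (z + w) - h z) / w).
  move=> e e0; have [|d d0 D] := H (e / 2); first by rewrite divr_gt0.
  exists d => // w /D; case: (eqVneq w 0) => [_|w0]; first by rewrite subrr normc0.
  rewrite -ler_pdivrMr ?normc_gt0// -normcV -normcM => /le_lt_trans.
  rewrite (_ : _ / w = (h (z + w) - h z) / w - l); last by field.
  by apply; lra.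
move=> w; case: (eqVneq w 0) => [->|w0]; last by field.
by rewrite addr0 mulr0 addr0.
Qed.

Definition cexp z : R[i] :=
  (expR (complex.Re z))%:C * (cos (complex.Im z) +i* sin (complex.Im z)).

Lemma cexpD z w : cexp (z + w) = cexp z * cexp w.
Proof.
case: z w => [x y] [u v]; rewrite /cexp /= expRD cosD sinD.
by apply: complex_eqP => /=; ring.
Qed.

Lemma normc_cexp z : normc (cexp z) = expR (complex.Re z).
Proof.
rewrite /cexp normcM normcR ger0_norm ?expR_ge0//.
by rewrite /= cos2Dsin2 sqrtr1 mulr1.
Qed.

Lemma is_derive_eps (f : R -> R) (x df : R) : is_derive x 1 f df ->
  forall e, 0 < e -> exists2 d : R, 0 < d &
  forall t, `|t| < d -> `|f (x + t) - f x - df * t| <= e * `|t|.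
Proof.
move=> [dvf fE] e e0.
have : (fun t : R => t^-1 *: ((f \o shift x) (t *: 1) - f x)) @ 0^' --> df.
  by rewrite -fE; exact: dvf.
move=> /cvgrPdist_le /(_ e e0) [d /= d0 D]; exists d => // t td.
have [->|t0] := eqVneq t 0; first by rewrite addr0 mulr0 subrr subr0 normr0 mulr0.
have := D t; rewrite /ball_/= sub0r normrN => /(_ td t0).
rewrite /GRing.scale/= mulr1 => /(ler_wpM2r (normr_ge0 t)); rewrite -normrM.
move=> tle; apply: le_trans tle.
rewrite le_eqVlt (addrC t x) distrC; apply/orP; left; apply/eqP; congr (`| _ |).
by field.
Qed.

End complex_calculus.

(** * Holomorphic maps into a half-plane *)

Section minimum_principle.
Context {R : realType}.
Implicit Types (x y r e d : R) (z w l : R[i]) (h k q : R[i] -> R[i]).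

Lemma cdiff_cexp z : cdiff cexp z (cexp z).
Proof.
have cexp0 : cexp 0 = 1 :> R[i].
  by rewrite /cexp/= expR0 cos0 sin0; apply: complex_eqP; rewrite /= ?mul1r ?mul0r ?subr0 ?addr0.
suff [q c E] : cdiff (@cexp R) 0 1.
  exists (fun w => cexp z * q w).
    by rewrite -[X in clim _ X]mulr1; apply: climM => //; exact: clim_cst.
  by move=> w; rewrite cexpD -[X in _ * cexp X]add0r E cexp0; ring.
apply: eps_cdiff => e e0.
(* The error terms [T1] to [T4] are at most 1, 2, 3 and 2 times [e' * n], which add up to the factor
   8. *)
have [e' [e'0 ee e1]] : exists e', [/\ 0 < e', e' <= e / 8 & e' <= 1].
  by exists (Num.min (e / 8) 1); rewrite lt_min divr_gt0/= ?ge_min ?lexx ?orbT.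
have dexp : is_derive (0 : R) 1 expR 1.
  by rewrite -[X in is_derive _ _ _ X]expR0; exact: is_derive_expR.
have dsin : is_derive (0 : R) 1 sin 1.
  by rewrite -[X in is_derive _ _ _ X]cos0; exact: is_derive_sin.
have dcos : is_derive (0 : R) 1 cos 0.
  by rewrite -[X in is_derive _ _ _ X]oppr0 -[X in - X]sin0; exact: is_derive_cos.
have [d1 d10 D1] := is_derive_eps dexp e'0.
have [d2 d20 D2] := is_derive_eps dsin e'0.
have [d3 d30 D3] := is_derive_eps dcos e'0.
exists (Num.min (Num.min d1 d2) (Num.min d3 e')); first by rewrite !lt_min d10 d20 d30.
move=> [x y]; rewrite !lt_min => /andP[/andP[w1 w2] /andP[w3 w4]].
set n := normc (x +i* y).
have xn : `|x| <= n := normc_Re (x +i* y).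
have yn : `|y| <= n := normc_Im (x +i* y).
have := D1 x (le_lt_trans xn w1); rewrite add0r expR0 mul1r => {}D1.
have := D2 y (le_lt_trans yn w2); rewrite add0r sin0 mul1r subr0 => {}D2.
have := D3 y (le_lt_trans yn w3); rewrite add0r cos0 mul0r subr0 => {}D3.
apply: le_trans (normc_ReIm _) _; rewrite add0r cexp0 /cexp/=.
have -> : expR x * cos y - 0 * sin y - 1 - (1 * x - 0 * y) =
  (expR x - 1 - x) * cos y + (1 + x) * (cos y - 1) by ring.
have -> : expR x * sin y + 0 * cos y - 0 - (1 * y + 0 * x) =
  expR x * (sin y - y) + (expR x - 1) * y by ring.
have n0 : 0 <= n := normc_ge0 _.
have n1 : n <= e' := ltW w4.
have D1' : `|expR x - 1 - x| <= e' * n by apply: le_trans D1 _; rewrite ler_pM2l.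
have D2' : `|sin y - y| <= e' * n by apply: le_trans D2 _; rewrite ler_pM2l.
have D3' : `|cos y - 1| <= e' * n by apply: le_trans D3 _; rewrite ler_pM2l.
have E1 : `|expR x - 1| <= 2 * n.
  rewrite -(subrK x (expR x - 1)); apply: le_trans (ler_normD _ _) _.
  have : e' * n <= n by rewrite ler_piMl.
  lra.
have E2 : `|expR x| <= 3.
  rewrite -(subrK 1 (expR x)); apply: le_trans (ler_normD _ _) _.
  by rewrite normr1; lra.
have C : `|cos y| <= 1 by rewrite ler_norml cos_geN1 cos_le1.
have X : `|1 + x| <= 2 by apply: le_trans (ler_normD _ _) _; rewrite normr1; lra.
have T1 : `|(expR x - 1 - x) * cos y| <= (e' * n) * 1 by rewrite normrM ler_pM.
have T2 : `|(1 + x) * (cos y - 1)| <= 2 * (e' * n) by rewrite normrM ler_pM.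
have T3 : `|expR x * (sin y - y)| <= 3 * (e' * n) by rewrite normrM ler_pM.
have T4 : `|(expR x - 1) * y| <= 2 * (e' * n).
  by rewrite normrM mulrA ler_pM//; apply: le_trans E1 _; rewrite ler_pM2l.
have E8 : e' * n <= e / 8 * n by rewrite ler_wpM2r.
apply: le_trans (lerD (ler_normD _ _) (ler_normD _ _)) _.
lra.
Qed.

Lemma cdiff_diff2 h x y l : cdiff h (x +i* y) l ->
  diff2 (fun s t => complex.Re (h (s +i* t))) (fun s t => complex.Im (h (s +i* t)))
    x y (complex.Re l) (complex.Im l).
Proof.
move=> /cdiff_eps H e e0; have [d d0 D] := H e e0.
exists (d / 2); first by rewrite divr_gt0.
move=> s t sd td.
have st : normc (s +i* t) <= `|s| + `|t| := normc_ReIm (s +i* t).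
have : normc (h ((x +i* y) + (s +i* t)) - h (x +i* y) - l * (s +i* t)) <= e * (`|s| + `|t|).
  apply: le_trans (D _ _) _; first by apply: le_lt_trans st _; rewrite (splitr d) ltrD.
  by rewrite ler_pM2l.
rewrite -[(x +i* y) + _]/((x + s) +i* (y + t)).
set k1 := h _; set k2 := h _ => H3; split; apply: le_trans H3.
- apply: le_trans (normc_Re _); case: k1 k2 l {H D} => [? ?] [? ?] [? ?] /=.
  by rewrite le_eqVlt; apply/orP; left; apply/eqP; congr (`| _ |); ring.
- apply: le_trans (normc_Im _); case: k1 k2 l {H D} => [? ?] [? ?] [? ?] /=.
  by rewrite le_eqVlt; apply/orP; left; apply/eqP; congr (`| _ |); ring.
Qed.

Lemma diff2_continuous (u v : R -> R -> R) (x y l1 l2 : R) : diff2 u v x y l1 l2 ->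
  {for x, continuous (u^~ y)} /\ {for y, continuous (v x)}.
Proof.
move=> D; have [d d0 {}D] := D 1 ltr01.
have n0 : 0 < `|l1| + 1 by rewrite ltr_wpDl.
split; apply/cvgrPdist_lt => e e0.
- exists (Num.min d (e / (`|l1| + 1))) => /=; first by rewrite lt_min d0 divr_gt0.
  move=> t /=; rewrite lt_min distrC => /andP[t1 t2].
  have [+ _] := D (t - x) 0 t1 ltac:(by rewrite normr0).
  rewrite addr0 mulr0 subr0 normr0 addr0 mul1r (addrC x) subrK => h.
  rewrite distrC -(subrK (l1 * (t - x)) (_ - _)).
  apply: le_lt_trans (ler_normD _ _) _; apply: le_lt_trans (lerD h (lexx _)) _.
  by rewrite normrM; move: t2; rewrite ltr_pdivlMr//; lra.
- exists (Num.min d (e / (`|l1| + 1))) => /=; first by rewrite lt_min d0 divr_gt0.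
  move=> t /=; rewrite lt_min distrC => /andP[t1 t2].
  have [_] := D 0 (t - y) ltac:(by rewrite normr0) t1.
  rewrite addr0 mulr0 add0r normr0 add0r mul1r (addrC y) subrK => h.
  rewrite distrC -(subrK (l1 * (t - y)) (_ - _)).
  apply: le_lt_trans (ler_normD _ _) _; apply: le_lt_trans (lerD h (lexx _)) _.
  by rewrite normrM; move: t2; rewrite ltr_pdivlMr//; lra.
Qed.

(** In the coordinate [log z], the circle [|z| = r] and a small circle around
    [0] are opposite sides of a rectangle whose other two sides cancel by
    periodicity, so [G] has the same mean over both circles. *)
Lemma center_minimum_principle G r : 0 < r < 1 ->
  (forall z, z != 0 -> normc z < 1 -> exists l, cdiff G z l) -> clim G (G 0) ->
  (forall z, normc z = r -> 0 <= complex.Re (G z)) -> 0 <= complex.Re (G 0).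
Proof.
move=> /andP[r0 r1] dG cG Gr; rewrite leNgt; apply/negP => G0.
(* Within [c] of [G 0] the real part is still negative, so a small circle carries only negative
   values and the large one only nonnegative ones. *)
pose c := - complex.Re (G 0) / 2.
have c0 : 0 < c by rewrite divr_gt0// oppr_gt0.
have [d d0 D] := cG c c0.
(* The factor [i] turns [Re (G (cexp s))] into the imaginary part [v] of [F], the one integrated
   along vertical sides, that is, along the circles. *)
pose F z := 'i%C * G (cexp z).
have dF z : complex.Re z < 0 -> exists l, cdiff F z l.
  move=> z0; have [||l H] := dG (cexp z); rewrite -?normc_gt0 ?normc_cexp ?expR_gt0 ?expR_lt1//.
  by eexists; apply: cdiffMl; apply: cdiff_comp (cdiff_cexp z) H.
pose x1 := ln r; pose x0 := Num.min (ln d) x1 - 1.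
have x10 : x1 < 0 by rewrite ln_lt0// r0.
have x0d : x0 < ln d by rewrite ltrBlDr ltr_pwDr// ge_min lexx.
have x01 : x0 < x1 by rewrite ltrBlDr ltr_pwDr// ge_min lexx orbT.
pose a := x0 - 1; pose b := x1 / 2; pose p := 2 * pi : R.
have p0 : 0 < p by rewrite mulr_gt0// pi_gt0.
pose u x y := complex.Re (F (x +i* y)); pose v x y := complex.Im (F (x +i* y)).
have duv x y : x < 0 -> exists l1 l2 : R, diff2 u v x y l1 l2.
  move=> x_0; have [l /cdiff_diff2 H] := dF (x +i* y) x_0.
  by exists (complex.Re l), (complex.Im l).
(* The antiderivative is chosen as a function of [f], not of the ordinate: equality of the functions
   [u^~ p] and [u^~ 0] then makes the two horizontal sides cancel literally. *)
have /choice[A HA] (f : R -> R) : exists U : R -> R,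
    (forall x, a <= x <= b -> {for x, continuous f}) ->
    forall x, a < x < b -> is_derive x 1 U (f x).
  have [cf|] := pselect (forall x, a <= x <= b -> {for x, continuous f}); last by exists id.
  by have [U HU] := antiderivative cf; exists U.
have /choice[B HB] x : exists U : R -> R, a < x < b -> forall y, -1 < y < p + 1 ->
    is_derive y 1 U (v x y).
  have [xab|] := pselect (a < x < b); last by exists id.
  have [|U HU] := @antiderivative R (v x) (-1) (p + 1); last by exists U.
  move=> y _; have [|l1 [l2 /diff2_continuous[]//]] := duv x y.
  by move: xab; rewrite /b; lra.
have dA x y : a < x < b -> -1 < y < p + 1 -> is_derive x 1 (A (u^~ y)) (u x y).
  move=> xab _; apply: HA => // t tab.
  have [|l1 [l2 /diff2_continuous[]//]] := duv t y.
  by move: tab; rewrite /b; lra.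
have := @goursat R u v a b (-1) (p + 1) (fun y => A (u^~ y)) B _ dA
  (fun x y xab => HB x xab y) x0 0 (x1 - x0) p.
move=> /(_ _ _ p0 _ _ _ _); rewrite add0r.
have -> : x0 + (x1 - x0) = x1 by rewrite addrC subrK.
have -> : u^~ p = u^~ 0.
  apply/funext => x; rewrite /u /F /cexp /= /p.
  by rewrite (mulrC 2) mulr_natr cos2pi sin2pi cos0 sin0.
rewrite subrr sub0r => H.
have {H}E : B x1 p - B x1 0 = B x0 p - B x0 0.
  have /eqP : - (B x1 p - B x1 0 - (B x0 p - B x0 0)) = 0.
    by apply: H; rewrite /a /b; try lra; move=> x y xab _; apply: duv; move: xab; rewrite /b; lra.
  by rewrite oppr_eq0 subr_eq0 => /eqP.
(* Each vertical integral is [p] times a single value of [Re G] on its circle, so comparing the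
   signs of two values is enough. *)
have mv x : a < x < b -> exists y, B x p - B x 0 = v x y * p.
  move=> xab; have [|y _ ->] := @mean_value R (B x) (v x) 0 p p0; last by exists y; rewrite subr0.
  by move=> y y0p; apply: HB => //; lra.
have vE x y : v x y = complex.Re (G (cexp (x +i* y))).
  by rewrite /v /F; case: (G _) => s t /=; ring.
have [y1 E1] : exists y, B x1 p - B x1 0 = v x1 y * p by apply: mv; rewrite /a /b; lra.
have [y0 E0] : exists y, B x0 p - B x0 0 = v x0 y * p by apply: mv; rewrite /a /b; lra.
have v1 : 0 <= v x1 y1 by rewrite vE; apply: Gr; rewrite normc_cexp/= lnK.
have v0 : v x0 y0 < 0.
  rewrite vE; set z := cexp _.
  have zd : normc z < d.
    by rewrite normc_cexp/= -[ltRHS]lnK ?posrE// ltr_expR.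
  have /(le_lt_trans (normc_Re _)) := D z zd.
  rewrite ltr_norml /c => /andP[_]; case: (G z) (G 0) G0 {D c0 cG c} => [? ?] [? ?] /=; lra.
have : v x1 y1 * p = v x0 y0 * p by rewrite -E1 -E0.
have : 0 <= v x1 y1 * p by rewrite mulr_ge0// ltW.
have : v x0 y0 * p < 0 by rewrite pmulr_llt0.
lra.
Qed.

End minimum_principle.

(** * The Schwarz-Pick inequality for maps into the right half-plane *)

Section schwarz_pick.
Context {R : realType}.
Implicit Types (x y r e d t : R) (z w l a b : R[i]) (h k q : R[i] -> R[i]).

Definition halfplane_map h := forall z, normc z < 1 ->
  (exists l, cdiff h z l) /\ 0 < complex.Re (h z).

Lemma cdiff_near h k z l :
  (exists2 d : R, 0 < d & forall w, normc w < d -> h (z + w) = k (z + w)) ->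
  cdiff h z l -> cdiff k z l.
Proof.
move=> [d d0 D] /cdiff_eps H; apply: eps_cdiff => e /H[d1 d10 D1].
exists (Num.min d d1); first by rewrite lt_min d0.
move=> w; rewrite lt_min => /andP[w1 w2]; rewrite -D//.
by have := D 0; rewrite addr0 normc0 => /(_ d0) <-; exact: D1.
Qed.

(** Carathéodory's bound: [Re h] is tested against the nonnegative kernel [2 + 2 Re (c z / r)]. On
    the circle the conjugate of [c z / r] is a multiple of [1 / z], which brings in the difference
    quotient [q]; at 0 this is known to be continuous, hence the form of
    [center_minimum_principle]. *)
Lemma derivative_center h l : halfplane_map h -> cdiff h 0 l ->
  normc l <= 2 * complex.Re (h 0).
Proof.
move=> hh hl; have [->|l0] := eqVneq l 0.
  by rewrite normc0 mulr_ge0// ltW//; have [|_] := hh 0; rewrite ?normc0.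
have nl : 0 < normc l by rewrite normc_gt0.
have nlC : (normc l)%:C != 0 :> R[i] by rewrite -normc_gt0 normcR normr_gt0 gt_eqF.
(* This rotation turns the linear coefficient into [- |l|], which makes [Re (G 0)] as small as
   possible. *)
have [c [nc cbl]] : exists c : R[i], normc c = 1 /\ c^*%C * l = - (normc l)%:C.
  exists (- l / (normc l)%:C); split.
    by rewrite normcM normcN normcV normcR ger0_norm ?ltW// mulfV// gt_eqF.
  rewrite conjcM conjcN -mulrA mulNr; congr (- _).
  rewrite conjc_inv conjc_real.
  by rewrite (mulrC _ l) mulrA mulrC (mulrC _ l) mulcJ realCX; field.
pose cb := c^*%C; rewrite -/cb in cbl.
suff main r : 0 < r < 1 -> r * normc l <= 2 * complex.Re (h 0).
  rewrite leNgt; apply/negP => lt.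
  have h0 : 0 < 2 * complex.Re (h 0).
    by rewrite mulr_gt0//; have [|_] := hh 0; rewrite ?normc0.
  have := main ((1 + 2 * complex.Re (h 0) / normc l) / 2).
  have q1 : 2 * complex.Re (h 0) / normc l < 1 by rewrite ltr_pdivrMr ?mul1r.
  have q0 : 0 < 2 * complex.Re (h 0) / normc l by rewrite divr_gt0.
  move=> /(_ ltac:(lra)).
  have -> : (1 + 2 * complex.Re (h 0) / normc l) / 2 * normc l =
     (normc l + 2 * complex.Re (h 0)) / 2 by field; rewrite gt_eqF.
  by move=> ?; lra.
move=> r01; case/andP: (r01) => r0 r1.
have rC : r%:C != 0 :> R[i] by rewrite -normc_gt0 normcR normr_gt0 gt_eqF.
pose q z := if z == 0 then l else (h z - h 0) / z.
have cq : clim q l.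
  case: hl => q1 c1 H1; apply: (clim_fix c1); last by rewrite /q eqxx.
  by move=> z z0; rewrite /q (negPf z0); have := H1 z; rewrite add0r => ->; field.
(* On [|z| = r], with [e = c z / r], the real part of [G z] is
   [Re (h z) * (2 + 2 Re e)], and [Re (G 0) = 2 Re (h 0) - r |l|]. *)
pose G z := h z * (2 + c / r%:C * z) + cb * r%:C * q z + c * (h 0)^*%C / r%:C * z.
have G0 : G 0 = 2 * h 0 + cb * l * r%:C by rewrite /G /q eqxx; ring.
have := @center_minimum_principle R G r r01; rewrite G0 cbl.
have -> : complex.Re (2 * h 0 + - (normc l)%:C * r%:C) = 2 * complex.Re (h 0) - r * normc l.
  by case: (h 0) => ? ? /=; ring.
rewrite subr_ge0; apply.
- move=> z z0 z1; have [[m hm] _] := hh z z1.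
  eexists; apply: cdiffD; last exact: cdiffMl (cdiff_id z).
  apply: cdiffD.
    apply: cdiffM hm _; apply: cdiffD; first exact: cdiff_cst.
    exact: cdiffMl (cdiff_id z).
  apply: cdiffMl.
  apply: (@cdiff_near (fun z => (h z + - h 0) * z^-1)); last first.
    by apply: cdiffM; [apply: cdiffD hm _; exact: cdiff_cst|exact: cdiffV].
  exists (normc z); first by rewrite normc_gt0.
  move=> w wz; rewrite /q; case: (eqVneq (z + w) 0) => // /eqP.
  by rewrite addr_eq0 => /eqP E; move: wz; rewrite E normcN ltxx.
- rewrite -cbl (_ : 2 * h 0 + cb * l * r%:C =
    h 0 * (2 + c / r%:C * 0) + cb * r%:C * l + c * (h 0)^*%C / r%:C * 0); last by ring.
  have := clim_cdiff hl; rewrite (_ : (fun w => h (0 + w)) = h);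
    last by apply/funext => w; rewrite add0r.
  move=> ch; have cid (m : R[i]) : clim (fun w => m * w) (m * 0).
    by apply: climM (clim_cst m) clim_id.
  apply: climD (cid _); apply: climD; last by apply: climM (clim_cst _) cq.
  by apply: climM ch _; apply: climD (cid _); exact: clim_cst.
- move=> z zr; have z1 : normc z < 1 by rewrite zr.
  have z0 : z != 0 by rewrite -normc_gt0 zr.
  have [_ hz] := hh z z1.
  pose e := c / r%:C * z.
  have ne : normc e = 1.
    by rewrite !normcM normcV nc normcR zr gtr0_norm// mul1r mulVf// gt_eqF.
  have ee : cb * r%:C / z = e^*%C.
    have E : z^-1 = z^*%C / r%:C ^+ 2.
      apply: (mulfI z0); rewrite mulrA mulcJ zr realCX !mulfV//.
      by rewrite expf_neq0.
    rewrite /e !conjcM -/cb conjc_inv conjc_real E; field.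
    by [].
  have -> : complex.Re (G z) = complex.Re (h z) * (2 + 2 * complex.Re e).
    have -> : G z = h z * (2 + e) + e^*%C * (h z - h 0) + e * (h 0)^*%C.
      rewrite -ee /G /q (negPf z0) /e; field.
      by rewrite z0 rC.
    case: (h z) (h 0) e {hz ne ee G0} => [? ?] [? ?] [? ?] /=; ring.
  rewrite mulr_ge0 ?(ltW hz)//.
  have := normc_Re e; rewrite ne ler_norml => /andP[+ _]; lra.
Qed.

Definition mobius a w := (w + a) / (1 + a^*%C * w).

Lemma mobius_denom a w : normc a < 1 -> normc w <= 1 -> 1 + a^*%C * w != 0.
Proof.
move=> a1 w1; apply/eqP => E.
have : normc (a^*%C * w) = 1.
  have -> : a^*%C * w = - 1 by apply/eqP; rewrite -addr_eq0 addrC E.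
  by rewrite normcN normc1.
rewrite normcM normc_conj => H; move: a1; rewrite -H ltNge => /negP; apply.
by rewrite ler_piMr// normc_ge0.
Qed.

Lemma normc_mobius a w : normc a < 1 -> normc w < 1 -> normc (mobius a w) < 1.
Proof.
move=> a1 w1; rewrite normcM normcV ltr_pdivrMr ?mul1r; last first.
  by rewrite normc_gt0 mobius_denom// ltW.
rewrite -(@ltr_pXn2r _ 2) ?nnegrE ?normc_ge0//.
(* The product is the difference of the squared moduli of the denominator and the numerator of
   [mobius a w]. *)
have : 0 < (1 - normc a ^+ 2) * (1 - normc w ^+ 2).
  by rewrite mulr_gt0// subr_gt0 expr_lt1 ?normc_ge0.
rewrite !normc_sqr; case: a w {a1 w1} => [x y] [u v] /=; lra.
Qed.

Lemma cdiff_mobius a w : normc a < 1 -> normc w < 1 -> exists l, cdiff (mobius a) w l.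
Proof.
move=> a1 w1; eexists; apply: cdiffM.
  by apply: cdiffD; [exact: cdiff_id|exact: cdiff_cst].
apply: (@cdiff_comp _ (fun z => z^-1) (fun z => 1 + a^*%C * z)).
  by apply: cdiffD; [exact: cdiff_cst|exact: cdiffMl (cdiff_id w)].
by apply: cdiffV; apply: mobius_denom => //; exact: ltW.
Qed.

Lemma cdiff_mobius0 a : cdiff (mobius a) 0 (1 - a * a^*%C).
Proof.
have -> : 1 - a * a^*%C =
    (1 + 0) * (1 + a^*%C * 0)^-1 + (0 + a) * (- (1 + a^*%C * 0) ^- 2 * (0 + a^*%C * 1)).
  by rewrite mulr0 addr0 expr1n invr1; ring.
apply: cdiffM.
  by apply: cdiffD; [exact: cdiff_id|exact: cdiff_cst].
apply: (@cdiff_comp _ (fun z => z^-1) (fun z => 1 + a^*%C * z)).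
  by apply: cdiffD; [exact: cdiff_cst|exact: cdiffMl (cdiff_id 0)].
by apply: cdiffV; rewrite mulr0 addr0 oner_neq0.
Qed.

Lemma halfplane_comp h a w : normc a < 1 -> normc w = 1 -> halfplane_map h ->
  halfplane_map (fun z => h (mobius a (w * z))).
Proof.
move=> a1 w1 hh z z1; have wz : normc (w * z) < 1 by rewrite normcM w1 mul1r.
have [[l hl] h0] := hh _ (normc_mobius a1 wz); split => //.
have [m hm] := cdiff_mobius a1 wz.
have cw : cdiff (fun z => w * z) z (w * 1) := cdiffMl w (cdiff_id z).
have cm : cdiff (fun z => mobius a (w * z)) z (m * (w * 1)) := cdiff_comp cw hm.
by exists (l * (m * (w * 1))); exact: cdiff_comp cm hl.
Qed.

(** Precomposition with [mobius t], which sends 0 to [t] with derivative [1 - t ^+ 2], reduces this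
    to [derivative_center]. *)
Lemma derivative_bound h l t : halfplane_map h -> 0 <= t < 1 -> cdiff h t%:C l ->
  normc l * (1 - t ^+ 2) <= 2 * complex.Re (h t%:C).
Proof.
move=> hh /andP[t0 t1] hl.
have tn : normc (t%:C : R[i]) < 1 by rewrite normcR ger0_norm.
have hc := halfplane_comp tn (normc1 R) hh.
have M0 : mobius t%:C (1 * 0) = t%:C by rewrite /mobius mulr0 mulr0 add0r addr0 divr1.
have E : 1 - t%:C * t%:C^*%C = (1 - t ^+ 2)%:C :> R[i] by rewrite conjc_real realCB realCX.
have dm : cdiff (fun z => mobius t%:C (1 * z)) 0 (1 - t ^+ 2)%:C.
  rewrite -E (_ : (fun z => _) = mobius t%:C); first exact: cdiff_mobius0.
  by apply/funext => z; rewrite mul1r.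
have := derivative_center hc (l := l * (1 - t ^+ 2)%:C).
rewrite M0 normcM normcR ger0_norm; last by rewrite subr_ge0 expr_le1// ltW.
by apply; apply: cdiff_comp dm _; rewrite M0.
Qed.

Lemma cdiff_is_derive h t l : cdiff h t%:C l ->
  is_derive t 1 (fun s : R => complex.Re (h s%:C)) (complex.Re l) /\
  is_derive t 1 (fun s : R => complex.Im (h s%:C)) (complex.Im l).
Proof.
move=> /cdiff_eps H.
have key (f : R -> R) (df : R) : (forall e, 0 < e -> exists2 d : R, 0 < d &
    forall s, `|s| < d -> `|f (t + s) - f t - df * s| <= e * `|s|) -> is_derive t 1 f df.
  move=> Hf.
  have cf : (fun s : R => s^-1 *: ((f \o shift t) (s *: 1) - f t)) @ 0^' --> df.
    apply/cvgrPdist_le => e /Hf[d d0 D]; exists d => //= s.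
    rewrite /ball_/= sub0r normrN => /D {}D s0.
    rewrite -(@ler_pM2r _ `|s|) ?normr_gt0// -normrM.
    apply: le_trans D; rewrite le_eqVlt distrC /GRing.scale/= mulr1 (addrC t).
    by apply/orP; left; apply/eqP; congr (`| _ |); field.
  by apply: DeriveDef; [exact: cvgP cf|exact: cvg_lim cf].
split; apply: key => e /H[d d0 D]; exists d => // s sd.
- have := D s%:C; rewrite normcR -realCD => /(_ sd); apply: le_trans.
  apply: le_trans (normc_Re _); case: (h _) (h _) l {H D} => [? ?] [? ?] [? ?] /=.
  by rewrite le_eqVlt; apply/orP; left; apply/eqP; congr (`| _ |); ring.
- have := D s%:C; rewrite normcR -realCD => /(_ sd); apply: le_trans.
  apply: le_trans (normc_Im _); case: (h _) (h _) l {H D} => [? ?] [? ?] [? ?] /=.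
  by rewrite le_eqVlt; apply/orP; left; apply/eqP; congr (`| _ |); ring.
Qed.

(** The modulus is bounded, rather than the real part, because it is multiplicative: an unknown
    complex factor cancels later in [collinear_lower]. The weight [p = (1 - s) / (1 + s)] satisfies
    [p' / p = - 2 / (1 - s ^+ 2)], opposite to the largest logarithmic growth of [|h|] that
    [derivative_bound] permits. *)
Lemma harnack_center h t : halfplane_map h -> 0 <= t < 1 ->
  normc (h t%:C) * ((1 - t) / (1 + t)) <= normc (h 0).
Proof.
move=> hh /andP[]; rewrite le_eqVlt => /orP[/eqP <- _|t0 t1].
  by rewrite subr0 addr0 divr1 mulr1.
have dh (s : R) : 0 <= s <= t -> exists l,
    cdiff h s%:C l /\ normc l * (1 - s ^+ 2) <= 2 * complex.Re (h s%:C).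
  move=> /andP[s0 st]; have s1 := le_lt_trans st t1.
  have [|[l hl] _] := hh s%:C; first by rewrite normcR ger0_norm.
  by exists l; split => //; apply: derivative_bound => //; rewrite s0.
pose u (s : R) := complex.Re (h s%:C); pose v s := complex.Im (h s%:C).
pose p (s : R) : R := 2 * (1 + s)^-1 - 1.
have ps (s : R) : 0 <= s -> p s = (1 - s) / (1 + s).
  by move=> s0; rewrite /p; field; rewrite gt_eqF// ltr_wpDr.
(* [f] decreases since [|h'(s)| (1 - s^2) <= 2 Re h(s) <= 2 |h(s)|]. *)
pose f (s : R) := (u s ^+ 2 + v s ^+ 2) * p s ^+ 2.
have fE (s : R) : 0 <= s -> f s = (normc (h s%:C) * ((1 - s) / (1 + s))) ^+ 2.
  by move=> s0; rewrite /f ps// [RHS]exprMn normc_sqr.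
have /choice[l hl] (s : R) : exists l, 0 <= s <= t ->
    cdiff h s%:C l /\ normc l * (1 - s ^+ 2) <= 2 * complex.Re (h s%:C).
  have [/dh[m Hm]|] := pselect (0 <= s <= t); last by exists 0.
  by exists m.
pose g (s : R) := (2 * u s * complex.Re (l s) + 2 * v s * complex.Im (l s)) * p s ^+ 2 +
   (u s ^+ 2 + v s ^+ 2) * (2 * p s * (- 2 * (1 + s) ^- 2)).
have dp (s : R) : 0 <= s -> is_derive s 1 p (- 2 * (1 + s) ^- 2).
  move=> s0; have s10 : 1 + s != 0 by rewrite gt_eqF// ltr_wpDr.
  have d1 : is_derive s 1 (fun s : R => 1 + s) (0 + 1) by apply: is_deriveD.
  have := is_deriveV s10 d1 => d2.
  have d3 : is_derive s 1 (fun s : R => 2 *: (1 + s)^-1 - cst 1 s)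
      (2 *: (- (1 + s) ^- 2 *: (0 + 1)) - 0).
    by apply: is_deriveB.
  apply: is_derive_eq d3 _.
  by rewrite subr0 add0r /GRing.scale/= mulr1 mulrN mulNr.
have df (s : R) : 0 <= s <= t -> is_derive s 1 f (g s).
  move=> st; have [/cdiff_is_derive[du dv] _] := hl s st.
  have dps := dp s (andP st).1.
  have sq (a : R -> R) (da : R) : is_derive s 1 a da ->
      is_derive s 1 (fun x => a x ^+ 2) (2 * a s * da).
    move=> da'; apply: is_derive_eq (is_deriveM da' da') _.
    by rewrite -[LHS]/(a s * da + a s * da); ring.
  apply: is_derive_eq (is_deriveM (is_deriveD (sq _ _ du) (sq _ _ dv)) (sq _ _ dps)) _.
  rewrite -[LHS]/((u s ^+ 2 + v s ^+ 2) * (2 * p s * (- 2 * (1 + s) ^- 2)) +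
    p s ^+ 2 * (2 * u s * complex.Re (l s) + 2 * v s * complex.Im (l s))) /g; ring.
have [s st Es] := mean_value t0 df.
have gs : g s <= 0.
  case/andP: (st) => s0 /le_lt_trans/(_ t1) s1.
  have [_ ls] := hl s st.
  pose n := normc (h s%:C).
  have n2 : u s ^+ 2 + v s ^+ 2 = n ^+ 2 by rewrite normc_sqr.
  have nn : 0 <= n := normc_ge0 _.
  have p0 : 0 < p s by rewrite ps// divr_gt0 ?subr_gt0// ltr_wpDr.
  have s2 : 0 < 1 - s ^+ 2 by rewrite subr_gt0 expr_lt1.
  have ln : normc (l s) * (1 - s ^+ 2) <= 2 * n.
    by apply: le_trans ls _; rewrite ler_pM2l//; apply: le_trans (ler_norm _) (normc_Re _).
  have cs : u s * complex.Re (l s) + v s * complex.Im (l s) <= n * normc (l s).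
    have : normc (h s%:C * (l s)^*%C) = n * normc (l s) by rewrite normcM normc_conj.
    move=> <-; apply: le_trans (normc_Re _); apply: le_trans (ler_norm _).
    by rewrite /u /v; case: (h _) (l s) => [? ?] [? ?] /=; lra.
  have -> : g s = 2 * p s *
      ((u s * complex.Re (l s) + v s * complex.Im (l s)) * p s - 2 * n ^+ 2 * (1 + s) ^- 2).
    by rewrite /g n2; ring.
  rewrite pmulr_rle0 ?mulr_gt0// subr_le0.
  apply: le_trans (_ : n * normc (l s) * p s <= _); first by rewrite ler_pM2r.
  have -> : 2 * n ^+ 2 * (1 + s) ^- 2 = n * (2 * n / (1 - s ^+ 2)) * p s.
    rewrite ps//; field.
    by rewrite !gt_eqF ?subr_gt0// ?ltr_wpDr// ; lra.
  rewrite ler_pM2r// ler_wpM2l//.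
  by rewrite ler_pdivlMr.
have : f t <= f 0.
  by rewrite -subr_le0 Es mulr_le0_ge0// subr_ge0 ltW.
have q0 : 0 <= (1 - t) / (1 + t) by rewrite divr_ge0 ?subr_ge0 ?addr_ge0// ltW.
rewrite !fE ?(ltW t0)// subr0 addr0 divr1 mulr1.
by rewrite ler_pXn2r ?nnegrE ?normc_ge0//; apply: mulr_ge0 q0; exact: normc_ge0.
Qed.

(** A Möbius map moves [a] to 0 and [b] to [c], a rotation moves [c] to the real point [m = |c|];
    there [harnack_center] bounds the ratio of moduli by [(1 + m) / (1 - m)], whose half logarithm
    is the Poincaré distance. *)
Lemma poincare_halfplane h a b : halfplane_map h -> normc a < 1 -> normc b < 1 ->
  2^-1 * ln (normc (h b) / normc (h a)) <= poincare_dist a b.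
Proof.
move=> hh a1 b1; rewrite /poincare_dist ler_pM2l ?invr_gt0//.
have nN : normc (- a) < 1 by rewrite normcN.
pose c := mobius (- a) b; have c1 : normc c < 1 := normc_mobius nN b1.
have d0 : 1 - a^*%C * b != 0.
  by have := mobius_denom nN (ltW b1); rewrite conjcN mulNr.
have cE : c = (b - a) / (1 - a^*%C * b) by rewrite /c /mobius conjcN mulNr.
have -> : normc ((a - b) / (1 - a^*%C * b)) = normc c.
  by rewrite cE !normcM -(normcN (a - b)) opprB.
set m := normc c.
have Mc : mobius a c = b.
  have e1 : 1 + a^*%C * c = (1 - a^*%C * a) / (1 - a^*%C * b) by rewrite cE; field.
  have e2 : c + a = b * (1 - a^*%C * a) / (1 - a^*%C * b) by rewrite cE; field.
  have e3 : 1 + a^*%C * c != 0 := mobius_denom a1 (ltW c1).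
  have e4 : 1 - a^*%C * a != 0 by apply: contra_neq e3 => E; rewrite e1 E mul0r.
  by rewrite /mobius e1 e2; field; rewrite d0 e4.
pose w := if c == 0 then 1 else c / m%:C.
have w1 : normc w = 1.
  rewrite /w; case: (eqVneq c 0) => [_|c0]; first by rewrite normc1.
  by rewrite normcM normcV normcR ger0_norm ?normc_ge0// mulfV// normc_eq0.
have wm : w * m%:C = c.
  rewrite /w /m; case: (eqVneq c 0) => [->|c0]; first by rewrite normc0 mul1r.
  rewrite mulfVK// -normc_eq0 normcR normr_eq0 normc_eq0//.
have hc := halfplane_comp a1 w1 hh.
have m0 : 0 <= m := normc_ge0 _.
have := @harnack_center _ m hc; rewrite wm Mc mulr0 m0 c1 => /(_ isT).
have -> : mobius a 0 = a by rewrite /mobius mulr0 add0r addr0 divr1.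
have posn z : normc z < 1 -> 0 < normc (h z).
  move=> /hh[_ hz]; rewrite normc_gt0; apply: contraTneq hz => ->.
  by rewrite ltxx.
have [hb ha] := (posn b b1, posn a a1).
have m1 : 0 < 1 - m by rewrite subr_gt0.
have m2 : 0 < 1 + m by rewrite ltr_wpDr.
move=> H; rewrite ler_ln ?posrE ?divr_gt0//.
rewrite ler_pdivrMr// mulrAC ler_pdivlMr//.
by move: H; rewrite mulrA ler_pdivrMr// (mulrC (1 + m)).
Qed.

End schwarz_pick.

(** * The Kobayashi distance *)

Section linear_forms.
Context {R : realType} {n : nat}.
Implicit Types (x y r e d t : R) (z w l : R[i]) (a p u v : 'rV[R[i]]_n)
  (Omega : set 'rV[R[i]]_n).

Definition lform a u : R[i] := \sum_(k < n) a ord0 k * u ord0 k.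

Lemma lformD a u v : lform a (u + v) = lform a u + lform a v.
Proof. by rewrite /lform -big_split; apply: eq_bigr => k _; rewrite mxE mulrDr. Qed.

Lemma lformZ a z u : lform a (z *: u) = z * lform a u.
Proof. by rewrite /lform mulr_sumr; apply: eq_bigr => k _; rewrite mxE mulrCA. Qed.

Lemma lformN a u : lform a (- u) = - lform a u.
Proof. by rewrite -scaleN1r lformZ mulN1r. Qed.

Lemma lformB a u v : lform a (u - v) = lform a u - lform a v.
Proof. by rewrite lformD lformN. Qed.

Lemma derivable_coord_eps (phi : R[i] -> 'rV[R[i]]_n) z : derivable phi z 1 ->
  exists v, forall e, 0 < e -> exists2 d : R, 0 < d & forall w, w != 0 -> normc w < d ->
    forall k, normc (v ord0 k - w^-1 * (phi (z + w) ord0 k - phi z ord0 k)) < e.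
Proof.
move=> /cvg_ex[v /= /cvg_ballP H]; exists v => e e0.
have e0C : 0 < e%:C :> R[i] by rewrite ltcR.
have [d /= d0 D] := H _ e0C; exists (complex.Re d).
  by move: d0; rewrite ltcE/= => /andP[].
move=> w w0 wd k.
have wb : ball_ [eta Num.Def.normr] 0 d w.
  rewrite /ball_/= sub0r normrN.
  move: d0 wd; case: d {D} => dr di; rewrite !ltcE/= => /andP[/eqP -> _] ->.
  by rewrite eqxx.
have [_ /(_ ord0 k)] := D w wb w0.
rewrite [X in X -> _](_ : _ = ball_ [eta Num.Def.normr] (v ord0 k) e%:C
   ((w^-1 *: (phi (w *: 1 + z) - phi z)) ord0 k))//.
rewrite /ball_/= !mxE ltcE/= => /andP[_].
by rewrite (_ : w *: 1 = w)// ?(addrC w)// /GRing.scale/= mulr1.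
Qed.

Lemma derivable_lform a (phi : R[i] -> 'rV[R[i]]_n) z : derivable phi z 1 ->
  exists l, cdiff (fun w => lform a (phi w)) z l.
Proof.
move=> /derivable_coord_eps[v H]; exists (lform a v).
apply: eps_cdiff => e e0; pose s := \sum_(k < n) normc (a ord0 k) + 1.
have s0 : 0 < s by rewrite ltr_wpDl// sumr_ge0// => k _; exact: normc_ge0.
have [|d d0 D] := H (e / s); first by rewrite divr_gt0.
exists d => // w wd; have [->|w0] := eqVneq w 0.
  by rewrite addr0 mulr0 subrr subr0 normc0 mulr0.
rewrite /lform -sumrB mulr_suml -sumrB.
have -> : \sum_(k < n) (a ord0 k * phi (z + w) ord0 k - a ord0 k * phi z ord0 k -
     a ord0 k * v ord0 k * w)
  = \sum_(k < n) (a ord0 k * (w^-1 * (phi (z + w) ord0 k - phi z ord0 k) - v ord0 k)) * w.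
  by apply: eq_bigr => k _; field.
rewrite -mulr_suml normcM ler_wpM2r ?normc_ge0//.
have ns (F : 'I_n -> R[i]) : normc (\sum_k F k) <= \sum_k normc (F k).
  elim/big_rec2: _ => [|k x y _ IH]; first by rewrite normc0.
  by apply: le_trans (le_normcD _ _) _; rewrite lerD2l.
apply: le_trans (ns _) _.
apply: le_trans (_ : \sum_(k < n) normc (a ord0 k) * (e / s) <= _).
  apply: ler_sum => k _; rewrite normcM ler_wpM2l ?normc_ge0//.
  by rewrite normcB ltW// D.
rewrite -mulr_suml mulrC -mulrA ler_piMr ?(ltW e0)//.
by rewrite mulrC ler_pdivrMr// mul1r lerDl.
Qed.

Lemma halfplane_disc Omega a p phi : holomorphic_disc Omega phi ->
  (forall u, Omega u -> 0 < complex.Re (lform a (u - p))) ->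
  halfplane_map (fun w => lform a (phi w - p)).
Proof.
move=> hphi ha z z1; have [dphi Oz] := hphi z z1; split; last exact: ha.
have [l hl] := derivable_lform a dphi; exists (l + 0).
rewrite (_ : (fun w => _) = (fun w => lform a (phi w) + - lform a p)); last first.
  by apply/funext => w; rewrite lformB.
by apply: cdiffD hl _; exact: cdiff_cst.
Qed.

End linear_forms.

Section kobayashi.
Context {R : realType} {n : nat}.
Implicit Types (x y r e d t l : R) (z w : R[i]) (a p u v : 'rV[R[i]]_n)
  (Omega : set 'rV[R[i]]_n).

(** The logarithms of the ratios telescope along the chain, so [poincare_halfplane] can be applied
    disc by disc. *)
Lemma disc_chain_lower Omega a p u v l :
  (forall u, Omega u -> 0 < complex.Re (lform a (u - p))) -> disc_chain Omega u v l ->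
  2^-1 * ln (normc (lform a (v - p)) / normc (lform a (u - p))) <= l.
Proof.
move=> ha; have pos u' : Omega u' -> 0 < normc (lform a (u' - p)).
  by move=> /ha h; rewrite normc_gt0; apply: contraTneq h => ->; rewrite ltxx.
have endp u' v' l' : disc_chain Omega u' v' l' -> Omega u' /\ Omega v'.
  elim=> [z Oz//|phi z w v1 l1 hphi z1 w1 _ [_ Ov]]; split => //.
  by have [] := hphi z z1.
elim=> [z Oz|phi z w v1 l1 hphi z1 w1 c IH].
  by rewrite divff ?ln1 ?mulr0// gt_eqF// pos.
have [Ow Ov] := endp _ _ _ c.
have Oz : Omega (phi z) by have [] := hphi z z1.
have := poincare_halfplane (halfplane_disc hphi ha) z1 w1.
move=> h; apply: le_trans (lerD h IH); rewrite -mulrDr -lnM ?posrE ?divr_gt0 ?pos//.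
rewrite le_eqVlt; apply/orP; left; apply/eqP; congr (_ * ln _); field.
by rewrite !gt_eqF ?pos.
Qed.

Lemma poincare_dist_sym z w : poincare_dist z w = poincare_dist w z.
Proof.
rewrite /poincare_dist; have -> // :
  normc ((z - w) / (1 - z^*%C * w)) = normc ((w - z) / (1 - w^*%C * z)).
rewrite !normcM normcB !normcV; congr (_ / _).
rewrite -(normc_conj (1 - _)); congr normc.
have -> : (1 - z^*%C * w)^*%C = 1 - (z^*%C * w)^*%C.
  by rewrite [LHS]rmorphB; congr (_ - _); exact: rmorph1.
by rewrite conjcM conjcK mulrC.
Qed.

Lemma disc_chain_cat Omega u v p l t : disc_chain Omega u v l -> disc_chain Omega v p t ->
  disc_chain Omega u p (l + t).
Proof.
move=> c; elim: c t => [z _ t|phi z w v1 l1 hphi z1 w1 _ IH t /IH H]; first by rewrite add0r.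
by rewrite -addrA; apply: disc_chain_cons.
Qed.

Lemma disc_chain1 Omega phi z w : holomorphic_disc Omega phi ->
  normc z < 1 -> normc w < 1 -> disc_chain Omega (phi z) (phi w) (poincare_dist z w).
Proof.
move=> hphi z1 w1; rewrite -[poincare_dist _ _]addr0; apply: disc_chain_cons => //.
by apply: disc_chain_nil; have [] := hphi w w1.
Qed.

Lemma disc_chain_sym Omega u v l : disc_chain Omega u v l -> disc_chain Omega v u l.
Proof.
elim=> [z Oz|phi z w v1 l1 hphi z1 w1 c IH]; first exact: disc_chain_nil.
by rewrite addrC poincare_dist_sym; apply: disc_chain_cat IH _; exact: disc_chain1.
Qed.

Lemma poincare_dist_ge0 z w : normc z < 1 -> normc w < 1 -> 0 <= poincare_dist z w.
Proof.
move=> z1 w1; rewrite /poincare_dist mulr_ge0 ?invr_ge0// ln_ge0//.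
set m := normc _; have m0 : 0 <= m := normc_ge0 _.
have m1 : m < 1.
  have zN : normc (- z) < 1 by rewrite normcN.
  have := normc_mobius zN w1; rewrite /mobius conjcN mulNr.
  by rewrite /m !normcM normcB.
by rewrite ler_pdivlMr ?subr_gt0// mul1r; lra.
Qed.

Lemma disc_chain_ge0 Omega u v l : disc_chain Omega u v l -> 0 <= l.
Proof.
by elim=> // phi z w v1 l1 hphi z1 w1 _ IH; rewrite addr_ge0// poincare_dist_ge0.
Qed.

Lemma kobayashi_le Omega u v l : disc_chain Omega u v l -> kobayashi_dist Omega u v <= l.
Proof.
by move=> c; apply: ge_inf => //; exists 0 => m /disc_chain_ge0.
Qed.

Lemma kobayashi_sym Omega u v : kobayashi_dist Omega u v = kobayashi_dist Omega v u.
Proof. by congr inf; apply/seteqP; split => l /disc_chain_sym. Qed.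

(** Since [inf] is 0 on the empty set, the triangle inequality and the lower bound for
    [kobayashi_dist] are stated under the existence of chains. *)
Definition chain_connected Omega :=
  forall u v, Omega u -> Omega v -> exists l, disc_chain Omega u v l.

Lemma kobayashi_triangle Omega u v p : chain_connected Omega ->
  Omega u -> Omega v -> Omega p ->
  kobayashi_dist Omega u p <= kobayashi_dist Omega u v + kobayashi_dist Omega v p.
Proof.
move=> cO Ou Ov Op; have [l1 c1] := cO u v Ou Ov; have [l2 c2] := cO v p Ov Op.
rewrite -lerBlDr; apply: lb_le_inf; first by exists l1.
move=> l cl; rewrite lerBlDr -lerBlDl; apply: lb_le_inf; first by exists l2.
move=> m cm; rewrite lerBlDl; apply: kobayashi_le; exact: disc_chain_cat cl cm.
Qed.

Lemma kobayashi_lower Omega a p u v : chain_connected Omega ->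
  (forall u, Omega u -> 0 < complex.Re (lform a (u - p))) -> Omega u -> Omega v ->
  2^-1 * ln (normc (lform a (v - p)) / normc (lform a (u - p))) <= kobayashi_dist Omega u v.
Proof.
move=> cO ha Ou Ov; have [l c] := cO u v Ou Ov.
by apply: lb_le_inf; [exists l|move=> m; exact: disc_chain_lower].
Qed.

End kobayashi.

(** * Convex domains *)

Section euclidean.
Context {R : realType} {n : nat}.
Implicit Types (x y r e d t : R) (z w l : R[i]) (a p u v X : 'rV[R[i]]_n)
  (Omega A : set 'rV[R[i]]_n).

Definition conjv u : 'rV[R[i]]_n := \row_k (u ord0 k)^*%C.

(** The Euclidean inner product of the underlying real space; being the real part of a
    complex-linear form in [u], it can be fed to [kobayashi_lower]. *)
Definition rdot u v : R := complex.Re (lform (conjv v) u).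

Definition sqnorm u : R := \sum_(k < n) normc (u ord0 k) ^+ 2.

Lemma sqnorm_ge0 u : 0 <= sqnorm u.
Proof. by apply: sumr_ge0 => k _; rewrite sqr_ge0. Qed.

Lemma enorm_sqr u : enorm u ^+ 2 = sqnorm u.
Proof. by rewrite /enorm sqr_sqrtr// sqnorm_ge0. Qed.

Lemma enorm_lt u r : 0 < r -> (enorm u < r) = (sqnorm u < r ^+ 2).
Proof.
by move=> r0; rewrite -enorm_sqr ltr_pXn2r ?nnegrE ?sqrtr_ge0// ltW.
Qed.

Lemma rdotE u v : rdot u v = \sum_(k < n) complex.Re ((v ord0 k)^*%C * u ord0 k).
Proof.
rewrite /rdot /lform; elim/big_rec2: _ => [//|k x y _ <-].
by rewrite mxE; case: (_ * _) y => [? ?] [? ?].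
Qed.

Lemma sqnormD u v : sqnorm (u + v) = sqnorm u + 2 * rdot u v + sqnorm v.
Proof.
rewrite /sqnorm rdotE mulr_sumr -!big_split; apply: eq_bigr => k _ /=.
by rewrite mxE !normc_sqr; case: (u _ _) (v _ _) => [? ?] [? ?] /=; ring.
Qed.

Lemma sqnormZ z u : sqnorm (z *: u) = normc z ^+ 2 * sqnorm u.
Proof.
by rewrite /sqnorm mulr_sumr; apply: eq_bigr => k _; rewrite mxE normcM exprMn.
Qed.

Lemma rdotZ x u v : rdot (x%:C *: u) v = x * rdot u v.
Proof. by rewrite /rdot lformZ; case: (lform _ _) => ? ? /=; ring. Qed.

Lemma rdotD u v p : rdot (u + v) p = rdot u p + rdot v p.
Proof. by rewrite /rdot lformD; case: (lform _ _) (lform _ _) => ? ? [? ?]. Qed.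

Lemma rdotC u v : rdot u v = rdot v u.
Proof.
rewrite !rdotE; apply: eq_bigr => k _.
by case: (u _ _) (v _ _) => [? ?] [? ?] /=; ring.
Qed.

Lemma rdotvv u : rdot u u = sqnorm u.
Proof. by rewrite rdotE; apply: eq_bigr => k _; rewrite mulrC mulcJ. Qed.

Lemma lformvv u : lform (conjv u) u = (sqnorm u)%:C.
Proof.
rewrite /lform /sqnorm; elim/big_rec2: _ => [//|k x y _ ->].
by rewrite mxE mulrC mulcJ -realCD.
Qed.

Lemma sqnorm_eq0 u : (sqnorm u == 0) = (u == 0).
Proof.
apply/eqP/eqP => [/eqP|->]; last first.
  by rewrite /sqnorm big1// => k _; rewrite mxE normc0 expr0n.
rewrite psumr_eq0 => [|k _]; last exact: sqr_ge0.
move=> /allP H; apply/rowP => k; rewrite mxE; apply/eqP.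
have := H k; rewrite mem_index_enum => /(_ isT).
by rewrite expf_eq0/= normc_eq0.
Qed.

Definition near_pt u v r := forall k, normc (v ord0 k - u ord0 k) < r.

Lemma near_ptP u v r : 0 < r -> near_pt u v r <-> ball u r%:C v.
Proof.
move=> r0; have r0C : 0 < r%:C :> R[i] by rewrite ltcR.
have E (z w : R[i]) : ball z r%:C w <-> normc (w - z) < r.
  rewrite (_ : ball z r%:C w = ball_ [eta Num.Def.normr] z r%:C w)// /ball_/=.
  by rewrite ltcE/= eqxx/= normcB.
split=> [uv|[_ uv] k]; last by apply/E.
by split=> // i j; rewrite (ord1 i); apply/E.
Qed.

Lemma open_near Omega u : open Omega -> Omega u ->
  exists2 r : R, 0 < r & forall v, near_pt u v r -> Omega v.
Proof.
rewrite openE => oO /oO; rewrite /interior -nbhs_ballE => -[d /= d0 D].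
have dr : d = (complex.Re d)%:C.
  by move: d0; rewrite ltcE/= => /andP[/eqP di _]; apply: complex_eqP => //=.
have d1 : 0 < complex.Re d by move: d0; rewrite ltcE => /andP[].
by exists (complex.Re d) => // v /(near_ptP _ _ d1); rewrite -dr => /D.
Qed.

Lemma closure_near A u : closure A u <->
  forall r, 0 < r -> exists2 v, A v & near_pt u v r.
Proof.
split=> [cA r r0|H B].
  have [v [Av /near_ptP uv]] := cA (ball u r%:C) (nbhsx_ballx u r%:C ltac:(by rewrite ltcR)).
  by exists v => //; apply: uv.
rewrite -nbhs_ballE => -[d /= d0 D].
have dr : d = (complex.Re d)%:C.
  by move: d0; rewrite ltcE/= => /andP[/eqP di _]; apply: complex_eqP => //=.
have d1 : 0 < complex.Re d by move: d0; rewrite ltcE => /andP[].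
have [v Av /(near_ptP _ _ d1) uv] := H _ d1.
by exists v; split => //; apply: D; rewrite dr.
Qed.

(** The added 1 keeps it positive at [u = 0], so that it can serve as a divisor. *)
Definition l1norm u : R := \sum_(k < n) normc (u ord0 k) + 1.

Lemma l1norm_gt0 u : 0 < l1norm u.
Proof. by rewrite ltr_wpDl// sumr_ge0// => k _; exact: normc_ge0. Qed.

Lemma near_line u v z r : normc z * l1norm v < r -> near_pt u (u + z *: v) r.
Proof.
move=> h k; rewrite !mxE [_ - _]addrC addKr normcM; apply: le_lt_trans h.
rewrite ler_wpM2l ?normc_ge0// /l1norm (bigD1 k)//= -addrA lerDl.
by rewrite addr_ge0// sumr_ge0// => j _; exact: normc_ge0.
Qed.

Lemma open_line Omega u v : open Omega -> Omega u ->
  exists2 r : R, 0 < r & forall z, normc z < r -> Omega (u + z *: v).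
Proof.
move=> oO /(open_near oO)[r r0 H]; exists (r / l1norm v).
  by rewrite divr_gt0// l1norm_gt0.
by move=> z; rewrite ltr_pdivlMr ?l1norm_gt0// => /near_line/H.
Qed.

End euclidean.

Section convex.
Context {R : realType} {n : nat} (Omega : set 'rV[R[i]]_n).
Implicit Types (x y r e d t : R) (z w l : R[i]) (a p u v X Y : 'rV[R[i]]_n).
Hypothesis Omega_convex : convex_domain Omega.

Let oO : open Omega. Proof. by case: Omega_convex. Qed.

Lemma convexP u v t : 0 <= t <= 1 -> Omega u -> Omega v ->
  Omega ((1 - t)%:C *: u + t%:C *: v).
Proof.
move=> /andP[t0 t1] Ou Ov; have [_ _ cO] := Omega_convex.
have h : Itv.spec (@Itv.num_sem R[i]) (Itv.Real `[0%Z, 1%Z]) (t%:C).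
  by rewrite /= /Itv.num_sem/= in_itv/= realE !ler0c t0/= -[1]/(1%:C) lecR.
have := cO v u (Itv.mk h).
rewrite !inE => /(_ Ov Ou).
by rewrite /conv/= [X in Omega X -> _](_ : _ = t%:C *: v + (1 - t)%:C *: u)
  ?(addrC (_ *: v))// realCB.
Qed.

(** The error made in replacing [v] by a nearby [v'] of [Omega] is shifted onto [u], magnified by
    [t / (1 - t)], and absorbed by a neighbourhood of [u]. *)
Lemma convex_closureP u v t : 0 <= t < 1 -> Omega u -> closure Omega v ->
  Omega ((1 - t)%:C *: u + t%:C *: v).
Proof.
move=> /andP[t0 t1] Ou cv; have [r r0 H] := open_near oO Ou.
have s0 : 0 < 1 - t by rewrite subr_gt0.
have s0C : (1 - t)%:C != 0 :> R[i] by rewrite -normc_gt0 normcR normr_gt0 gt_eqF.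
have [|v' Ov' vv'] := (closure_near Omega v).1 cv (r * (1 - t)); first by rewrite mulr_gt0.
have -> : (1 - t)%:C *: u + t%:C *: v =
    (1 - t)%:C *: (u + (t / (1 - t))%:C *: (v - v')) + t%:C *: v'.
  apply/rowP => k; rewrite !mxE realCM realCV; field.
  by move: s0C; rewrite realCB.
apply: convexP => //; first by rewrite t0 ltW.
apply: H => k; rewrite !mxE [_ - _]addrC addKr normcM normcR ger0_norm ?divr_ge0// ?(ltW s0)//.
have := vv' k; rewrite normcB => h.
apply: le_lt_trans (_ : 1 / (1 - t) * normc (v ord0 k - v' ord0 k) < _).
  by rewrite ler_wpM2r ?normc_ge0// ler_wpM2r ?invr_ge0// ltW.
by rewrite mul1r mulrC ltr_pdivrMr.
Qed.

Lemma closure_convexP u v t : 0 <= t <= 1 -> closure Omega u -> closure Omega v ->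
  closure Omega ((1 - t)%:C *: u + t%:C *: v).
Proof.
move=> t01 /closure_near cu /closure_near cv; apply/closure_near => r r0.
have r2 : 0 < r / 2 by rewrite divr_gt0.
have [u' Ou' uu'] := cu _ r2; have [v' Ov' vv'] := cv _ r2.
exists ((1 - t)%:C *: u' + t%:C *: v'); first exact: convexP.
case/andP: t01 => t0 t1 k; rewrite !mxE.
have -> : (1 - t)%:C * u' ord0 k + t%:C * v' ord0 k - ((1 - t)%:C * u ord0 k + t%:C * v ord0 k)
  = (1 - t)%:C * (u' ord0 k - u ord0 k) + t%:C * (v' ord0 k - v ord0 k) by ring.
apply: le_lt_trans (le_normcD _ _) _; rewrite !normcM !normcR !ger0_norm ?subr_ge0//.
rewrite (splitr r) ltr_leD//.
  apply: le_lt_trans (uu' k); rewrite ler_piMl ?normc_ge0//; lra.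
by apply: le_trans (ltW (vv' k)); rewrite ler_piMl ?normc_ge0.
Qed.

(** If the closure contained the line through [u], then [Omega] would contain the parallel line
    through [m]: [m + z Y] is a convex combination of [u + (z / t) Y] and of [m + s (m - u)], a
    point of [Omega] slightly beyond [m]. *)
Lemma line_in_closure u Y : Y != 0 -> ~ contains_complex_line Omega ->
  exists z, ~ closure Omega (u + z *: Y).
Proof.
move=> Y0 nl; apply: contrapT => H; apply: nl.
have {}H z : closure Omega (u + z *: Y) by apply: contrapT => h; apply: H; exists z.
have [_ [m Om] _] := Omega_convex.
have [r r0 Hr] := open_line (m - u) oO Om.
pose s := Num.min (r / 2) 1.
have s0 : 0 < s by rewrite lt_min divr_gt0/=.
have sr : s < r by rewrite gt_min; apply/orP; left; lra.
pose t := s / (1 + s).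
have t0 : 0 < t by rewrite divr_gt0// addr_gt0.
have t1 : t < 1 by rewrite ltr_pdivrMr ?addr_gt0// mul1r ltrDr.
have ts : s = t / (1 - t) by rewrite /t; field; lra.
have tC : t%:C != 0 :> R[i] by rewrite -normc_gt0 normcR normr_gt0 gt_eqF.
have t1C : (1 - t)%:C != 0 :> R[i] by rewrite -normc_gt0 normcR normr_gt0 gt_eqF// subr_gt0.
exists m, Y; split => // z.
have -> : m + z *: Y = (1 - t)%:C *: (m + s%:C *: (m - u)) + t%:C *: (u + (z / t%:C) *: Y).
  rewrite ts realCM realCV; apply/rowP => k; rewrite !mxE; field.
  by move: tC t1C; rewrite realCB => -> ->.
apply: convex_closureP; [by rewrite ltW| |exact: H].
by apply: Hr; rewrite normcR gtr0_norm.
Qed.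

Lemma disc_segment u v : Omega u -> Omega (u + v) -> exists2 e : R, 0 < e &
  forall t z, 0 <= t <= 1 -> normc z < e -> Omega (u + (t%:C + z) *: v).
Proof.
move=> Ou Ov; have [d d0 D] := open_line v oO Ou; have [e e0 E] := open_line v oO Ov.
exists (Num.min d e); first by rewrite lt_min d0.
move=> t z t01; rewrite lt_min => /andP[/D zd /E ze].
have -> : u + (t%:C + z) *: v = (1 - t)%:C *: (u + z *: v) + t%:C *: (u + v + z *: v).
  by rewrite realCB; apply/rowP => k; rewrite !mxE; ring.
exact: convexP.
Qed.

Lemma affine_disc u v r z w : 0 < r -> (forall z, normc z < r -> Omega (u + z *: v)) ->
  normc z < r -> normc w < r ->
  disc_chain Omega (u + z *: v) (u + w *: v) (poincare_dist (z / r%:C) (w / r%:C)).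
Proof.
move=> r0 H zr wr; have rC : r%:C != 0 :> R[i] by rewrite -normc_gt0 normcR normr_gt0 gt_eqF.
pose phi (b : R[i]) := u + (r%:C * b) *: v.
have E b : u + b *: v = phi (b / r%:C) by rewrite /phi mulrC mulfVK.
have n1 b : normc b < r -> normc (b / r%:C) < 1.
  by move=> br; rewrite normcM normcV normcR gtr0_norm// ltr_pdivrMr// mul1r.
rewrite !E; apply: disc_chain1; [|exact: n1|exact: n1].
move=> b; rewrite /unit_disc/= => b1; split; last first.
  by apply: H; rewrite normcM normcR gtr0_norm// -[ltRHS]mulr1 ltr_pM2l.
apply/cvg_ex; exists (r%:C *: v); apply/cvg_ballP => e e0; exists 1 => //= h _ h0.
rewrite (_ : h^-1 *: _ = r%:C *: v); first exact: ballxx.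
rewrite /phi; apply/rowP => k; rewrite !mxE (_ : h *: 1 = h); last by rewrite /GRing.scale/= mulr1.
by field.
Qed.

(** The constant is the Poincaré distance from 0 to 1/2: the cost of a hop from the centre of an
    affine disc to half its radius. *)
Lemma poincare0_le w : normc w <= 2^-1 -> poincare_dist 0 w <= 2^-1 * ln 3.
Proof.
move=> w2; rewrite /poincare_dist ler_pM2l ?invr_gt0//.
have -> : normc ((0 - w) / (1 - 0^*%C * w)) = normc w.
  by rewrite conjc0 mul0r subr0 divr1 sub0r normcN.
have w0 : 0 <= normc w := normc_ge0 w.
have d0 : 0 < 1 - normc w by lra.
rewrite ler_ln ?posrE ?divr_gt0//; last lra.
by rewrite ler_pdivrMr//; lra.
Qed.

Lemma segment_chain u v e N s t : 0 < e ->
  (forall t z, 0 <= t <= 1 -> normc z < e -> Omega (u + (t%:C + z) *: v)) ->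
  0 <= s <= 1 -> 0 <= t <= 1 -> `|t - s| <= N%:R * (e / 2) ->
  exists2 l, l <= N%:R * (2^-1 * ln 3) & disc_chain Omega (u + s%:C *: v) (u + t%:C *: v) l.
Proof.
move=> e0 H s01; elim: N t => [|N IH] t t01.
  rewrite mul0r normr_le0 subr_eq0 => /eqP ->; exists 0; first by rewrite mul0r.
  by apply: disc_chain_nil; have := H s 0 s01; rewrite normc0 addr0; apply.
(* The last of [N + 1] equal hops starts here; its length is at most [e / 2], half the radius of the
   affine discs. *)
move=> ts; pose t' := s + N%:R / N.+1%:R * (t - s).
have N1 : 0 < N.+1%:R :> R by rewrite ltr0n.
have [q [q0 q1]] : exists q : R, [/\ 0 <= q & q <= 1] /\ q = N%:R / N.+1%:R.
  exists (N%:R / N.+1%:R); split => //; split; first by rewrite divr_ge0.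
  by rewrite ler_pdivrMr// mul1r ler_nat.
case: q0 => q0 q1'.
have t'01 : 0 <= t' <= 1.
  rewrite /t' -q1; case/andP: s01 t01 => s0 s1 /andP[t0 t1].
  have -> : s + q * (t - s) = (1 - q) * s + q * t by ring.
  apply/andP; split; first by rewrite addr_ge0// mulr_ge0// subr_ge0.
  have : (1 - q) * s <= 1 - q by rewrite ler_piMr// subr_ge0.
  have : q * t <= q by rewrite ler_piMr.
  lra.
have [|l lN c] := IH t' t'01.
  rewrite /t' [_ - s]addrC addKr normrM ger0_norm ?divr_ge0// mulrAC ler_pdivrMr//.
  by rewrite -mulrA ler_wpM2l// mulrC.
have tt : `|t - t'| <= e / 2.
  have -> : t - t' = (t - s) / N.+1%:R by rewrite /t' -natr1; field; rewrite natr1 gt_eqF.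
  by rewrite normrM normfV (gtr0_norm N1) ler_pdivrMr// mulrC.
have eC : normc (e%:C : R[i]) = e by rewrite normcR gtr0_norm.
exists (l + poincare_dist (0 / e%:C) ((t - t')%:C / e%:C)).
  rewrite -natr1 mulrDl mul1r lerD// mul0r poincare0_le//.
  by rewrite normcM normcV eC normcR ler_pdivrMr// mulrC.
have : disc_chain Omega (u + t'%:C *: v + (0 : R[i]) *: v) (u + t'%:C *: v + (t - t')%:C *: v)
    (poincare_dist (0 / e%:C) ((t - t')%:C / e%:C)).
  apply: affine_disc => //.
  - by move=> z ze; rewrite -addrA -scalerDl; exact: H.
  - by rewrite normc0.
  - by rewrite normcR; apply: le_lt_trans tt _; lra.
rewrite scale0r addr0 -addrA -scalerDl -realCD [t' + _]addrC subrK.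
exact: disc_chain_cat c.
Qed.

Lemma segment_chain_bound u v : Omega u -> Omega (u + v) -> exists K : R,
  forall s t, 0 <= s <= 1 -> 0 <= t <= 1 ->
    exists2 l, l <= K & disc_chain Omega (u + s%:C *: v) (u + t%:C *: v) l.
Proof.
move=> Ou Ouv; have [e e0 H] := disc_segment Ou Ouv.
pose N := (Num.truncn (2 / e)).+1.
exists (N%:R * (2^-1 * ln 3)) => s t s01 t01.
apply: (segment_chain e0 H) => //.
have : 2 / e < N%:R by rewrite truncnS_gt.
rewrite ltr_pdivrMr// => h.
apply: le_trans (_ : 1 <= _); last lra.
by rewrite ler_norml; lra.
Qed.

Lemma convex_chain_connected : chain_connected Omega.
Proof.
move=> u v Ou Ov; have [|K H] := @segment_chain_bound u (v - u) Ou.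
  by rewrite addrC subrK.
have [||l _] := H 0 1; [lra|lra|].
by rewrite scale0r addr0 scale1r (addrC u) subrK; exists l.
Qed.

(** The disc of radius [r] about height [r] has height 0 on its rim. On its diameter
    [(1 + m) / (1 - m)] is [y / x] times [(2 r - x) / (2 r - y)], a factor at most 2 since [y <= r];
    this is the additive error of the vertical rays. *)
Lemma vertical_le u X r x y : 0 < x <= y -> y <= r ->
  (forall z, normc z < r -> Omega (u + (r%:C + z) *: X)) ->
  kobayashi_dist Omega (u + x%:C *: X) (u + y%:C *: X) <= 2^-1 * ln (y / x) + 2^-1 * ln 2.
Proof.
move=> /andP[x0 xy] yr H.
have y0 : 0 < y by apply: lt_le_trans xy.
have r0 : 0 < r by apply: lt_le_trans yr.
have rC : r%:C != 0 :> R[i] by rewrite -normc_gt0 normcR normr_gt0 gt_eqF.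
have E t : u + t%:C *: X = (u + r%:C *: X) + (t - r)%:C *: X.
  by rewrite -addrA -scalerDl -realCD (addrC r) subrK.
have n1 t : 0 < t -> t <= r -> normc ((t - r)%:C : R[i]) < r.
  by move=> t0 tr; rewrite normcR ler0_norm ?subr_le0//; lra.
rewrite (E x) (E y); apply: le_trans (kobayashi_le (affine_disc r0 _ _ _)) _.
- by move=> z /H; rewrite -addrA -scalerDl.
- exact: n1 (le_trans xy yr).
- exact: n1.
rewrite /poincare_dist -mulrDr ler_pM2l ?invr_gt0//.
rewrite -lnM ?posrE ?divr_gt0//.
set m := normc _.
have mE : m = (y - x) * r / (r * x + r * y - x * y).
  have D0 : 0 < r * x + r * y - x * y.
    have : 0 < x * (r - y) + r * y; last lra.
    by rewrite ltr_wpDl// ?mulr_gt0// mulr_ge0 ?(ltW x0)// subr_ge0.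
  rewrite /m conjcM conjc_inv !conjc_real -!realCV -!realCM -[1 - _]/(1%:C - _) -!realCB.
  rewrite -realCV -realCM normcR.
  have -> : ((x - r) / r - (y - r) / r) / (1 - (x - r) / r * ((y - r) / r)) =
      - ((y - x) * r / (r * x + r * y - x * y)).
    by field; rewrite !gt_eqF.
  rewrite normrN ger0_norm// divr_ge0 ?(ltW D0)// mulr_ge0 ?(ltW r0)// subr_ge0//.
have D0 : 0 < r * x + r * y - x * y.
  have : 0 < x * (r - y) + r * y; last lra.
  by rewrite ltr_wpDl// ?mulr_gt0// mulr_ge0 ?(ltW x0)// subr_ge0.
have x1 : 0 < 2 * r - y by lra.
have E1 : (1 + m) / (1 - m) = y * (2 * r - x) / (x * (2 * r - y)).
  have -> : 1 + m = y * (2 * r - x) / (r * x + r * y - x * y).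
    by rewrite mE; field; rewrite gt_eqF.
  have -> : 1 - m = x * (2 * r - y) / (r * x + r * y - x * y).
    by rewrite mE; field; rewrite gt_eqF.
  by field; rewrite !gt_eqF.
have E2 : y / x * 2 = y * (4 * r - 2 * y) / (x * (2 * r - y)).
  by field; rewrite !gt_eqF.
rewrite E1 E2 ler_ln ?posrE.
- by rewrite ler_pM2r ?invr_gt0 ?mulr_gt0// ler_pM2l//; lra.
- by rewrite divr_gt0// mulr_gt0//; lra.
- by rewrite divr_gt0// mulr_gt0//; lra.
Qed.

End convex.

(** * Separating and supporting half-spaces *)

Section separation.
Context {R : realType} {n : nat}.
Implicit Types (x y r e d t : R) (z w l : R[i]) (a p u v X Y : 'rV[R[i]]_n)
  (Omega A : set 'rV[R[i]]_n).

Lemma rect_compact (x y M : R) :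
  compact [set z : R[i] | `|complex.Re z - x| <= M /\ `|complex.Im z - y| <= M].
Proof.
pose f (q : R * R) : R[i] := q.1 +i* q.2.
have -> : [set z : R[i] | `|complex.Re z - x| <= M /\ `|complex.Im z - y| <= M] =
    f @` (`[x - M, x + M] `*` `[y - M, y + M]).
  apply/seteqP; split=> [z [h1 h2]|_ [[s t] [/= h1 h2] <-]]; last first.
    by move: h1 h2; rewrite !in_itv/= => h1 h2; split; rewrite ler_norml/=; lra.
  exists (complex.Re z, complex.Im z); last by rewrite /f /=; case: (z).
  by move: h1 h2; rewrite !ler_norml => h1 h2; split; rewrite /= in_itv/=; lra.
apply: continuous_compact; last by apply: compact_setX; exact: segment_compact.
apply: continuous_subspaceT => -[s t]; apply/cvg_ballP => e e0.
have [er e1 eE] : exists2 er : R, 0 < er & e = er%:C.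
  move: e0; case: e => er ei; rewrite ltcE/= => /andP[/eqP -> ?].
  by exists er.
have e2 : 0 < er / 2 by rewrite divr_gt0.
exists (ball s (er / 2), ball t (er / 2)); first by split; exact: nbhsx_ballx.
move=> [s' t'] [/= h1 h2]; rewrite eE.
suff : ball_ [eta Num.Def.normr] (f (s, t)) er%:C (f (s', t')) by [].
rewrite /ball_/= ltcE/= eqxx/=.
apply: le_lt_trans (normc_ReIm ((s - s') +i* (t - t'))) _.
by rewrite (splitr er) ltrD.
Qed.

Lemma sqnorm_continuous p : continuous (fun u => sqnorm (u - p)).
Proof.
move=> u; apply/(@cvgrPdist_lt _ _ _ (nbhs u) (nbhs_filter u)) => e e0.
pose a := u - p; pose M := 2 * l1norm a + n%:R.
have M0 : 0 < M by rewrite ltr_pwDl// mulr_gt0// l1norm_gt0.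
pose r := Num.min 1 (e / M).
have r0 : 0 < r by rewrite lt_min ltr01 divr_gt0.
have r1 : r <= 1 by rewrite ge_min lexx.
have rM : M * r <= e by rewrite mulrC -ler_pdivlMr// ge_min lexx orbT.
rewrite -nbhs_ballE; exists r%:C; first by rewrite /= ltcR.
move=> v /(near_ptP _ _ r0) uv.
have -> : v - p = a + (v - u) by rewrite /a [RHS]addrC addrA subrK.
set h := v - u; have hk k : normc (h ord0 k) < r by rewrite !mxE; exact: uv.
have -> : sqnorm a - sqnorm (a + h) = - (2 * rdot a h + sqnorm h) by rewrite (sqnormD a h); ring.
rewrite normrN.
have ha : `|rdot a h| <= (l1norm a - 1) * r.
  rewrite rdotE; apply: le_trans (ler_norm_sum _ _ _) _.
  rewrite /l1norm addrK mulr_suml; apply: ler_sum => k _.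
  apply: le_trans (normc_Re _) _; rewrite normcM normc_conj mulrC.
  by rewrite ler_wpM2l ?normc_ge0// ltW.
have hh : `|sqnorm h| <= n%:R * r.
  rewrite ger0_norm ?sqnorm_ge0// -[n in n%:R]card_ord -sum1_card natr_sum mulr_suml.
  apply: ler_sum => k _; rewrite expr2 mul1r.
  apply: le_trans (_ : r * r <= _); last by rewrite ler_piMl// ltW.
  by rewrite ler_pM ?normc_ge0// ltW.
apply: le_lt_trans (ler_normD _ _) _; rewrite normrM ger0_norm//.
move: rM; rewrite /M; lra.
Qed.

Lemma quadratic_slope_ge0 (D E : R) : 0 <= E ->
  (forall t, 0 < t < 1 -> 0 <= 2 * t * D + t ^+ 2 * E) -> 0 <= D.
Proof.
move=> E0 H; rewrite leNgt; apply/negP => D0.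
have E1 : 0 < E + 1 by lra.
have [t [t0 t1 tE]] : exists t, [/\ 0 < t, t < 1 & t * (E + 1) <= - D].
  have q0 : 0 < - D / (E + 1) by rewrite divr_gt0 ?oppr_gt0.
  exists (Num.min (- D / (E + 1)) 2^-1); rewrite -ler_pdivlMr// ge_min lexx; split => //.
    by rewrite lt_min q0 invr_gt0/=.
  by rewrite gt_min; apply/orP; right; lra.
have := H t ltac:(by rewrite t0); have : t * (t * (E + 1)) <= t * - D by rewrite ler_pM2l.
have : 0 < t * t by rewrite mulr_gt0.
have : t * D < 0 by rewrite pmulr_rlt0.
lra.
Qed.

(** The form is given by the vector from [p] to the nearest point [v] of the closure: moving from
    [v] towards [u] cannot decrease the distance to [p], which to first order says
    [0 <= rdot (u - v) (v - p)]. *)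
Lemma separation Omega p : convex_domain Omega -> ~ closure Omega p ->
  exists a, forall u, Omega u -> 0 < complex.Re (lform a (u - p)).
Proof.
move=> cO ncp; have [oO [m Om] _] := cO.
pose M := enorm (m - p).
have M0 : 0 <= M by exact: sqrtr_ge0.
pose B k := [set z : R[i] | `|complex.Re z - complex.Re (p ord0 k)| <= M /\
  `|complex.Im z - complex.Im (p ord0 k)| <= M].
(* Points of the closure outside this compact box are farther from [p] than [m] is, so a minimum
   over [K] is a global one. *)
pose K := [set v : 'rV[R[i]]_n | forall k, B k (v ord0 k)] `&` closure Omega.
have small v : sqnorm (v - p) <= sqnorm (m - p) -> forall k, B k (v ord0 k).
  move=> vm k; suff h : normc ((v - p) ord0 k) <= M.
    move: h; rewrite /B/= !mxE; case: (v ord0 k) (p ord0 k) => [? ?] [? ?] h.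
    have h1 := le_trans (normc_Re _) h; have h2 := le_trans (normc_Im _) h.
    by split.
  rewrite -(@ler_pXn2r _ 2) ?nnegrE ?normc_ge0// enorm_sqr; apply: le_trans vm.
  by rewrite /sqnorm (bigD1 k)//= lerDl sumr_ge0// => j _; rewrite sqr_ge0.
have cK : compact K.
  apply: compact_closedI; last exact: closed_closure.
  by apply: rV_compact => k; exact: rect_compact.
have [||v vK vmin] := compact_EVT_min _ cK (f := fun u => sqnorm (u - p)).
- by exists m; split; [exact: small|exact: subset_closure].
- by apply: continuous_subspaceT => x; exact: sqnorm_continuous.
move: vK; rewrite inE => -[vB cv].
have vmin' u : Omega u -> sqnorm (v - p) <= sqnorm (u - p).
  move=> Ou; have [um|/ltW um] := leP (sqnorm (u - p)) (sqnorm (m - p)).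
    by apply: vmin; rewrite inE; split; [exact: small|exact: subset_closure].
  apply: le_trans um; apply: vmin; rewrite inE; split; [exact: small|exact: subset_closure].
have vp : 0 < sqnorm (v - p).
  rewrite lt0r sqnorm_ge0 andbT sqnorm_eq0 subr_eq0; apply: contra_notN ncp => /eqP <-.
  exact: cv.
exists (conjv (v - p)) => u Ou; rewrite -/(rdot (u - p) (v - p)).
have -> : u - p = (v - p) + (u - v) by rewrite [RHS]addrC addrA subrK.
rewrite (rdotD (v - p)) (rdotvv (v - p)); set D := rdot (u - v) (v - p).
suff D0 : 0 <= D by exact: ltr_pwDl.
apply: (@quadratic_slope_ge0 _ (sqnorm (u - v)) (sqnorm_ge0 _)) => t t01.
have /vmin' : Omega ((1 - (1 - t))%:C *: u + (1 - t)%:C *: v).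
  by apply: (convex_closureP cO _ Ou cv); lra.
have -> : (1 - (1 - t))%:C *: u + (1 - t)%:C *: v - p = (v - p) + t%:C *: (u - v).
  by rewrite subKr realCB; apply/rowP => k; rewrite !mxE; ring.
rewrite (sqnormD (v - p)) (sqnormZ _ (u - v)) (rdotC (v - p)) (rdotZ _ (u - v)) -/D normcR.
have /andP[t0 _] := t01.
by rewrite (gtr0_norm t0) -addrA lerDl mulrA.
Qed.

Lemma ball_in_domain Omega p r : convex_domain Omega -> Omega p -> 0 < r ->
  bdist Omega p = r%:E -> forall u, sqnorm (u - p) < r ^+ 2 -> Omega u.
Proof.
move=> cO Op r0 bp u up; have [oO _ _] := cO; apply: contrapT => nu.
pose T := [set t : R | 0 <= t <= 1 /\ Omega (p + t%:C *: (u - p))].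
have T0 : T 0 by split; [rewrite lexx ler01|rewrite scale0r addr0].
have hs : has_sup T by split; [exists 0|exists 1 => t [/andP[]]].
(* The segment from [p] to [u] would leave [Omega] at a boundary point [w]
   at distance less than [r]. *)
pose t0 := sup T; pose w := p + t0%:C *: (u - p).
have t00 : 0 <= t0 by apply: ub_le_sup; [exact: hs.2|].
have t01 : t0 <= 1 by apply: ge_sup; [exact: hs.1|move=> t [/andP[]]].
have wt t : p + t%:C *: (u - p) = w + (t - t0)%:C *: (u - p).
  by rewrite -addrA -scalerDl -realCD [t0 + _]addrC subrK.
have cw : closure Omega w.
  apply/closure_near => e e0.
  have l0 := l1norm_gt0 (u - p).
  have [|t [t01' Ot] tt] := sup_adherent (_ : 0 < e / l1norm (u - p)) hs.
    by rewrite divr_gt0.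
  exists (p + t%:C *: (u - p)) => //; rewrite wt; apply: near_line.
  have : t <= t0 by apply: (ub_le_sup hs.2); split.
  rewrite -ltr_pdivlMr// normcR => tle; rewrite ler0_norm ?subr_le0// opprB ltrBlDr -ltrBlDl.
  exact: tt.
have nw : ~ Omega w.
  move=> Ow; have [e e0 E] := open_line (u - p) oO Ow.
  have t1 : t0 < 1.
    rewrite lt_neqAle t01 andbT; apply: contra_notN nu => /eqP t1.
    by move: Ow; rewrite /w t1 scale1r addrC subrK.
  pose s := Num.min (e / 2) (1 - t0).
  have s0 : 0 < s by rewrite lt_min divr_gt0// subr_gt0.
  have se : s < e by rewrite gt_min; apply/orP; left; lra.
  have s1 : s <= 1 - t0 by rewrite ge_min lexx orbT.
  have : t0 + s <= t0.
    apply: ub_le_sup; first exact: hs.2.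
    split; first by lra.
    by rewrite wt [_ - t0]addrC addKr; apply: E; rewrite normcR gtr0_norm.
  lra.
have bw : boundary Omega w by split => // /interior_subset.
have : (r%:E <= (enorm (p - w))%:E)%E.
  by rewrite -bp; apply: ereal_inf_lbound; exists w.
rewrite lee_fin leNgt => /negP; apply; rewrite enorm_lt// /w opprD addNKr -scaleNr sqnormZ.
rewrite normcN normcR ger0_norm//; apply: le_lt_trans up.
by rewrite ler_piMl ?sqnorm_ge0// expr_le1.
Qed.

(** If some [u] of [Omega] lay on the negative side, the segment from [u] prolonged beyond [p] would
    enter a ball tangent at [p], and convexity would put [p] into [Omega]. Openness then makes the
    inequality strict. *)
Lemma inner_balls_support Omega p X d : convex_domain Omega -> ~ Omega p -> 0 < d ->
  sqnorm X = 1 ->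
  (forall r u, 0 < r < d -> sqnorm (u - (p + r%:C *: X)) < r ^+ 2 -> Omega u) ->
  forall u, Omega u -> 0 < complex.Re (lform (conjv X) (u - p)).
Proof.
move=> cO np d0 X1 HB; have [oO _ _] := cO.
have weak u : Omega u -> 0 <= rdot (u - p) X.
  move=> Ou; rewrite leNgt; apply/negP => D0; apply: np.
  set D := rdot _ _ in D0; pose E := sqnorm (u - p) + 1; pose r := d / 2.
  have E0 : 0 < E := ltr_wpDl (sqnorm_ge0 _) ltr01.
  have r0 : 0 < r by rewrite divr_gt0.
  (* The squared distance from [p - t (u - p)] to the centre is [t ^+ 2 * sqnorm (u - p) + 2 * t * r
     * D + r ^+ 2]; this [t] brings it below [r ^+ 2]. *)
  pose t := r * - D / E.
  have t0 : 0 < t by rewrite divr_gt0// mulr_gt0// oppr_gt0.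
  have tE : t * E = r * - D by rewrite /t divfK// gt_eqF.
  have Oy : Omega (p - t%:C *: (u - p)).
    apply: (HB r); first by rewrite /r; lra.
    rewrite (_ : _ - _ = (- t)%:C *: (u - p) + (- r)%:C *: X); last first.
      by apply/rowP => k; rewrite !mxE !realCN; ring.
    rewrite sqnormD !sqnormZ X1 !normcR rdotZ rdotC rdotZ rdotC -/D !normrN !gtr0_norm//.
    have -> : sqnorm (u - p) = E - 1 by rewrite /E addrK.
    have : t * (t * E) = t * (r * - D) by rewrite tE.
    have : 0 < t * t by rewrite mulr_gt0.
    have : 0 < t * (r * - D) by rewrite mulr_gt0// mulr_gt0// oppr_gt0.
    lra.
  have s0 : 0 < 1 + t by lra.
  have -> : p = (1 - t / (1 + t))%:C *: (p - t%:C *: (u - p)) + (t / (1 + t))%:C *: u.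
    have tC : (1 + t)%:C != 0 :> R[i] by rewrite -normc_gt0 normcR normr_gt0 gt_eqF.
    apply/rowP => k; rewrite realCB realCM realCV !mxE; field.
    by move: tC; rewrite realCD.
  apply: (convexP cO) => //; rewrite divr_ge0 ?(ltW t0) ?(ltW s0)//=.
  by rewrite ler_pdivrMr// mul1r; lra.
move=> u Ou; rewrite lt0r -/(rdot (u - p) X) weak// andbT; apply/eqP => D0.
have [e e0 H] := open_line X oO Ou.
have := weak _ (H (- (e / 2))%:C ltac:(by rewrite normcR normrN gtr0_norm; lra)).
rewrite addrAC rdotD D0 add0r rdotZ rdotvv X1; lra.
Qed.

End separation.

(** * Gromov hyperbolicity *)

Section hyperbolic.
Context {R : realType} {T : Type} (A : set T) (dist : T -> T -> R) (D : R).
Hypothesis D0 : 0 <= D.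
Hypothesis dist_sym : forall x y, dist x y = dist y x.
Hypothesis hyp : forall o x y z, A o -> A x -> A y -> A z ->
  Num.min (gromov_product dist o x y) (gromov_product dist o y z) - D <=
    gromov_product dist o x z.

Lemma four_point x y z w : A x -> A y -> A z -> A w ->
  dist x z + dist y w <= Num.max (dist x y + dist z w) (dist x w + dist y z) + 2 * D.
Proof.
move=> Ax Ay Az Aw; have := hyp Aw Ax Ay Az; rewrite /gromov_product.
by rewrite minElt maxElt; case: ifP => _; case: ifP; lra.
Qed.

(** Consecutive products growing at rate [D] absorb the defect [D] that each
    use of hyperbolicity costs. *)
Lemma gromov_product_chain o (x : nat -> T) C : A o -> (forall i, A (x i)) ->
  (forall i, D * i%:R - C <= gromov_product dist o (x i) (x i.+1)) ->
  forall k i, D * i%:R - C - D <= gromov_product dist o (x i) (x (i + k).+1).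
Proof.
move=> Ao Ax H; elim=> [|k IH] i.
  by rewrite addn0; apply: le_trans (H i); rewrite gerBl.
apply: le_trans (hyp Ao (Ax i) (Ax i.+1) (Ax _)); rewrite lerB// le_min H/=.
have := IH i.+1; rewrite addSn addnS -natr1 => IHi.
move: IHi; rewrite mulrDr mulr1. lra.
Qed.

Variables (U V : R -> T) (t0 c M : R).
Hypotheses (AU : forall t, t0 <= t -> A (U t)) (AV : forall t, t0 <= t -> A (V t)).
Hypothesis c0 : 0 <= c.
Hypothesis Uray : forall s t, t0 <= s <= t -> dist (U s) (U t) <= t - s + c.
Hypothesis Vray : forall s t, t0 <= s <= t -> dist (V s) (V t) <= t - s + c.
Hypothesis UVge : forall s t, t0 <= s <= t -> t - s <= dist (U s) (V t).
Hypothesis VUge : forall s t, t0 <= s <= t -> t - s <= dist (V s) (U t).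
Hypothesis UVbounded : forall t, t0 <= t -> dist (U t) (V t) <= M.

(** [M] only decides how far along the rays to go. Once [r - s] exceeds [M], the four-point
    inequality on [U s], [V s], [V r], [U r] bounds the diagonal by [r - s + 2 * c + 2 * D]. A
    second use, on [U t0], [U t], [V r], [V t] with the diagonals [U t0 V t] and [U t V r] so
    bounded, gives the claim. *)
Lemma asymptotic_rays t : t0 + `|M| <= t -> dist (U t) (V t) <= 4 * c + 6 * D.
Proof.
have cross s r : t0 <= s -> s + `|M| <= r -> dist (U s) (V r) <= r - s + 2 * c + 2 * D.
  move=> ts sr; have M0 := ler_norm M; have M1 := normr_ge0 M.
  have sr' : t0 <= s <= r by lra.
  have tr : t0 <= r by lra.
  have := four_point (AU ts) (AV ts) (AV tr) (AU tr).
  have := UVbounded ts; have := UVbounded tr; rewrite (dist_sym (V r)).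
  have := Uray sr'; have := Vray sr'; have := VUge sr'.
  by have c0' := c0; rewrite maxElt; case: ifP => _; lra.
move=> tt; have M0 := ler_norm M; have M1 := normr_ge0 M.
pose r := t + `|M|.
have t0t : t0 <= t by lra.
have t0r : t0 <= r by rewrite /r; lra.
have := four_point (AU (lexx t0)) (AU t0t) (AV t0r) (AV t0t).
have := cross t0 t (lexx _) tt; have := cross t r t0t ltac:(rewrite /r; lra).
have := @UVge t0 r ltac:(rewrite /r; lra); have := @Uray t0 t ltac:(lra).
have := @Vray t r ltac:(rewrite /r; lra); rewrite (dist_sym (V r)).
by have [c0' D0'] := (c0, D0); rewrite maxElt; case: ifP => _; lra.
Qed.

End hyperbolic.

(** * Non-Goldilocks segments *)

Lemma measurable_fun_divid (R : realType) (H : R -> R) (d : R) :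
  measurable_fun `]0, d[ H -> measurable_fun `]0, d[ (fun r : R => H r / r).
Proof.
move=> mH; apply: measurable_funM => //.
apply: open_continuous_measurable_fun => [|r]; first exact: interval_open.
rewrite inE/= in_itv/= => /andP[r0 _]; apply: continuousV; first by rewrite gt_eqF.
exact: cvg_id.
Qed.

(** * From the divergent integral to a divergent series *)

Section divergent_samples.
Context {R : realType} (H : R -> R) (d q C : R).
Hypotheses (d_gt0 : 0 < d) (q01 : 0 < q < 1).
Hypothesis mH : measurable_fun `]0, d[ H.
Hypothesis H_ge0 : forall r, 0 < r < d -> 0 <= H r.
Hypothesis H_le : forall r, 0 < r < d -> H r <= C.
Hypothesis intH : (\int[lebesgue_measure]_(r in `]0%R, d[) (H r / r)%:E = +oo)%E.

Let a i : R := d * q ^+ i.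

Let a_gt0 i : 0 < a i.
Proof. by have /andP[q0 _] := q01; rewrite mulr_gt0// exprn_gt0. Qed.

Let a_lt i : a i.+1 < a i.
Proof.
have /andP[q0 q1] := q01.
by rewrite /a exprS mulrCA gtr_pMl// a_gt0.
Qed.

Let a_le i j : (i <= j)%N -> a j <= a i.
Proof.
elim: j => [|j IH]; first by rewrite leqn0 => /eqP ->.
rewrite leq_eqVlt => /orP[/eqP ->//|/IH]; apply: le_trans.
exact/ltW/a_lt.
Qed.

Let a0 : a 0 = d. Proof. by rewrite /a mulr1. Qed.

Lemma half_sup_sample i : exists s, a i.+1 <= s < a i /\
  forall r, a i.+1 <= r < a i -> H r <= 2 * H s.
Proof.
have in0 r : a i.+1 <= r < a i -> 0 < r < d.
  move=> /andP[r1 r2]; rewrite (lt_le_trans (a_gt0 _) r1)/=.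
  by rewrite -a0 (lt_le_trans r2)// a_le.
have aI : a i.+1 <= a i.+1 < a i by rewrite lexx a_lt.
pose E := [set H r | r in [set r | a i.+1 <= r < a i]].
have hs : has_sup E.
  split; first by exists (H (a i.+1)); exists (a i.+1).
  by exists C => _ [r /= /in0 /H_le rC <-].
have Er r : a i.+1 <= r < a i -> H r <= sup E.
  by move=> rI; apply: (ub_le_sup hs.2); exists r.
(* If the supremum is 0, [H] vanishes on the whole interval and any point serves; otherwise half the
   supremum is exceeded somewhere. *)
have [s0|s0] := leP (sup E) 0.
  exists (a i.+1); split => // r rI.
  apply: le_trans (Er r rI) _; apply: le_trans s0 _.
  by rewrite mulr_ge0// H_ge0// in0.
have s2 : 0 < sup E / 2 by rewrite divr_gt0.
have [_ [s /= sI <-] sE] := sup_adherent s2 hs.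
exists s; split => // r rI; apply: le_trans (Er r rI) _.
move: sE; lra.
Qed.

(** [H] is not assumed monotone, so near-suprema replace endpoint values. The integral of [H r / r]
    over [[a i.+1, a i[] is at most [2 * H (s i) / q], hence bounded sums would bound the whole
    integral. The free index [i0] lets the path start at any height. *)
Lemma divergent_samples : exists s : nat -> R,
  (forall i, a i.+1 <= s i < a i) /\
  forall i0 B, exists N, B < \sum_(i0 <= i < N) H (s i).
Proof.
have /andP[q0 q1] := q01.
have /choice[s sP] := half_sup_sample; exists s; split=> [i|i0 B]; first exact: (sP i).1.
apply: contrapT => nB.
have sd i : 0 < s i < d.
  have [/andP[s1 s2] _] := sP i; rewrite (lt_le_trans (a_gt0 _) s1)/=.
  by rewrite -a0 (lt_le_trans s2)// a_le.
have Hs i : 0 <= H (s i) by rewrite H_ge0.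
pose B' := \sum_(0 <= i < i0) H (s i) + B.
have sumB N : \sum_(0 <= i < N) H (s i) <= B'.
  apply: le_trans (_ : \sum_(0 <= i < i0 + N) H (s i) <= _).
    rewrite [leRHS](@big_cat_nat _ _ _ N)//= ?leq_addl// lerDl sumr_ge0//.
  rewrite (@big_cat_nat _ _ _ i0)//= ?leq_addr// lerD2l leNgt.
  by apply/negP => BN; apply: nB; exists (i0 + N)%N.
pose I i := `[a i.+1, a i[%classic : set R.
have UI : `]0, d[%classic = \bigcup_i I i.
  apply/seteqP; split=> [r|r [i _]]; rewrite /= !in_itv/=; last first.
    move=> /andP[r1 r2]; rewrite (lt_le_trans (a_gt0 _) r1)/=.
    by rewrite -a0 (lt_le_trans r2)// a_le.
  move=> /andP[r0 rd].
  have ex : exists n, a n <= r.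
    have rd0 : 0 < r / d by rewrite divr_gt0.
    have := @cvg_expr R q; rewrite ger0_norm ?(ltW q0)// => /(_ q1) /cvgrPdist_lt.
    move=> /(_ _ rd0)[n _ /(_ n (leqnn n))].
    rewrite sub0r normrN ger0_norm ?exprn_ge0 ?(ltW q0)// => qn.
    by exists n; rewrite /a mulrC -ler_pdivlMr// ltW.
  case: (ex_minnP ex) => -[|n] an nmin; first by move: an; rewrite a0 leNgt rd.
  exists n => //; rewrite /I/= in_itv/= an/= ltNge; apply/negP => /nmin.
  by rewrite ltnn.
have triv : trivIset [set: nat] I.
  apply: ltn_trivIset => i j ij; rewrite predeqE => r; split=> // -[].
  rewrite /I/= !in_itv/= => /andP[r1 r2] /andP[r3 r4].
  by have := le_lt_trans r1 r4; rewrite ltNge a_le.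
have mHr := measurable_fun_divid mH.
have pos r : `]0, d[%classic r -> (0 <= (H r / r)%:E)%E.
  by rewrite /= in_itv/= => rd; rewrite lee_fin divr_ge0 ?H_ge0//; case/andP: rd => /ltW.
have piece i : (\int[lebesgue_measure]_(r in I i) (H r / r)%:E <= (2 * H (s i) / q)%:E)%E.
  have sub : I i `<=` `]0, d[%classic by rewrite UI; exact: bigcup_sup.
  apply: le_trans (_ : (\int[lebesgue_measure]_(r in I i) cst (2 * H (s i) / a i.+1)%:E r <= _)%E).
    apply: ge0_le_integral.
    - exact: measurable_itv.
    - by move=> r rI; apply: pos; exact: sub rI.
    - by apply/measurable_EFinP; apply: measurable_funS mHr => //; exact: measurable_itv.
    - exact: measurable_cst.
    - move=> r rI; rewrite lee_fin; move: rI; rewrite /I/= in_itv/= => rI.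
      have r0 : 0 < r by case/andP: rI => r1 _; apply: lt_le_trans r1.
      apply: le_trans (_ : 2 * H (s i) / r <= _).
        by rewrite ler_pM2r ?invr_gt0//; exact: (sP i).2.
      rewrite ler_wpM2l ?mulr_ge0//.
      by rewrite lef_pV2 ?posrE//; case/andP: rI.
  rewrite integral_cst; last exact: measurable_itv.
  have mu : lebesgue_measure [set` `[a i.+1, a i[] = (a i - a i.+1)%:E.
    by rewrite lebesgue_measure_itv/= lte_fin a_lt.
  rewrite [X in (_ * X)%E](_ : _ = (a i - a i.+1)%:E); last exact: mu.
  rewrite -EFinM lee_fin.
  apply: le_trans (_ : 2 * H (s i) / a i.+1 * a i <= _).
    apply: ler_wpM2l; last by rewrite gerBl ltW.
    by apply: divr_ge0; [apply: mulr_ge0|exact: ltW].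
  rewrite /a exprS le_eqVlt; apply/orP; left; apply/eqP; field.
  by rewrite !gt_eqF// exprn_gt0.
move: intH; rewrite UI ge0_integral_bigcup; last 4 first.
- by move=> i; exact: measurable_itv.
- by rewrite -UI; apply/measurable_EFinP.
- by move=> r; rewrite -UI; exact: pos.
- exact: triv.
apply/eqP; rewrite lt_eqF//.
apply: le_lt_trans (_ : (2 * B' / q)%:E < +oo)%E; last exact: ltry.
apply: le_trans (lee_nneseries (v := fun i => (2 * H (s i) / q)%:E) _ _) _.
- move=> i _ _; apply: integral_ge0 => r rI; apply: pos; rewrite UI.
  by exists i.
- by move=> i _; exact: piece.
apply: lime_le; first by apply: is_cvg_nneseries => i _ _; rewrite lee_fin divr_ge0 ?mulr_ge0// ltW.
apply: nearW => N; rewrite sumEFin lee_fin -mulr_suml -mulr_sumr.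
by rewrite ler_pM2r ?invr_gt0// ler_pM2l.
Qed.

End divergent_samples.

(** * Linear arithmetic of the descending path *)

Section path_estimates.
Context {R : realType}.

(** In the path estimates [t2], [t3], [ld] stand for [ln 2], [ln 3], [ln d], and [si], [sj] for
    logarithms of sampled heights; [a], [b], [c] are distances or Gromov products. *)
Lemma step_estimate (a b t2 t3 D ld i si sj : R) : a <= 2^-1 * t3 ->
  b <= 2^-1 * (si - sj) + 2^-1 * t2 -> si <= ld - 2 * D * i ->
  ld - 2 * D * (i + 1) - 2 * D <= sj -> a + b <= 2^-1 * t3 + 2 * D + 2^-1 * t2.
Proof. by move=> *; lra. Qed.

Lemma product_estimate (a b c t2 K D ld i si sj : R) : c <= K ->
  2^-1 * (ld - t2 - si) <= a -> 2^-1 * (ld - t2 - sj) <= b ->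
  si <= ld - 2 * D * i -> sj <= ld - 2 * D * (i + 1) -> 0 <= D ->
  D * i - (t2 + K) / 2 <= 2^-1 * (a + b - c).
Proof. by move=> *; lra. Qed.

Lemma ray_estimate (a b c t2 D ld i si sj : R) : c <= 2^-1 * (sj - si) + 2^-1 * t2 ->
  2^-1 * (ld - t2 - si) <= a -> 2^-1 * (ld - t2 - sj) <= b ->
  sj <= ld - 2 * D * i -> 0 <= t2 -> D * i - t2 <= 2^-1 * (a + b - c).
Proof. by move=> *; lra. Qed.

Lemma chain_estimate (a b c t2 C D i : R) : 0 <= t2 -> 0 <= D -> 0 <= C ->
  D * i - C - D <= a -> D * i - t2 <= b -> Num.min a b - D <= c ->
  D * i - (C + 2 * D + t2) <= c.
Proof. by move=> ? ? ? ? ?; rewrite minElt; case: ifP => _ *; lra. Qed.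

Lemma final_estimate (a b c t2 K C D ld i si : R) : D * i - C <= 2^-1 * (a + b - c) ->
  a <= 2^-1 * (ld - t2 - si) + K -> b <= 2^-1 * (ld - t2 - si) + K ->
  ld - 2 * D * i - 2 * D <= si -> 0 <= t2 -> c <= 2 * D + 2 * K + 2 * C.
Proof. by move=> *; lra. Qed.

Lemma exponent_estimate (a t : R) : - 2^-1 * a <= t -> - 2 * t <= a.
Proof. by lra. Qed.

End path_estimates.

(** * The drifting path, the face and the contradiction *)

Section boundary_segment.
Context {R : realType} {n : nat} (Omega : set 'rV[R[i]]_n).
Hypothesis Omega_convex : convex_domain Omega.
Hypothesis Omega_no_line : ~ contains_complex_line Omega.
Variables (P X Y : 'rV[R[i]]_n) (l d : R) (H : R -> R).
Hypotheses (l_gt0 : 0 < l) (d_gt0 : 0 < d) (X1 : sqnorm X = 1) (Y0 : Y != 0).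

Local Notation pt z r := (P + z *: Y + r%:C *: X).
Local Notation k := (kobayashi_dist Omega).

Hypothesis notin : forall x : R, 0 <= x <= l -> ~ Omega (P + x%:C *: Y).
Hypothesis inner : forall (x r : R) u, 0 <= x <= l -> 0 < r < d ->
  sqnorm (u - pt x%:C r) < r ^+ 2 -> Omega u.
Hypothesis Hdisc : forall (x r c : R) (z : R[i]), 0 <= x <= l -> 0 < r < d ->
  c < H r -> normc z < c -> Omega (pt x%:C r + z *: Y).
Hypothesis H_ge0 : forall r, 0 < r < d -> 0 <= H r.
Hypothesis mH : measurable_fun `]0, d[ H.
Hypothesis intH : (\int[lebesgue_measure]_(r in `]0%R, d[) (H r / r)%:E = +oo)%E.

Implicit Types (x y r s t e : R) (z w : R[i]) (u v : 'rV[R[i]]_n).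

Let connected : chain_connected Omega := convex_chain_connected Omega_convex.

Let l0 : 0 <= (0 : R) <= l. Proof. by rewrite lexx ltW. Qed.

Lemma pt_addY z w r : pt z r + w *: Y = pt (z + w) r.
Proof. by rewrite scalerDl [LHS]addrAC addrA. Qed.

Lemma vertical_disc x r z : 0 <= x <= l -> 0 < r < d -> normc z < r ->
  Omega (P + x%:C *: Y + (r%:C + z) *: X).
Proof.
move=> xl rd zr; apply: (inner xl rd).
rewrite scalerDl addrA [_ - _]addrC addKr sqnormZ X1 mulr1.
by rewrite ltr_pXn2r ?nnegrE ?normc_ge0//; case/andP: rd => /ltW.
Qed.

Lemma pt_in x r : 0 <= x <= l -> 0 < r < d -> Omega (pt x%:C r).
Proof.
move=> xl rd; rewrite -[r%:C]addr0; apply: vertical_disc => //.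
by rewrite normc0; case/andP: rd.
Qed.

Let pt0 r : P + r%:C *: X = pt (0 : R)%:C r.
Proof. by rewrite scale0r addr0. Qed.

Lemma pt0_in r : 0 < r < d -> Omega (P + r%:C *: X).
Proof. by rewrite pt0; exact: pt_in. Qed.

Lemma support u : Omega u -> 0 < complex.Re (lform (conjv X) (u - P)).
Proof.
have np := notin l0; rewrite scale0r addr0 in np.
apply: (inner_balls_support Omega_convex np d_gt0 X1) => r v rd.
by rewrite pt0; exact: inner.
Qed.

(** Makes the suprema in [half_sup_sample] finite. The source is the absence of complex lines: one
    point off the closure at height [d / 2] limits the discs at every height. *)
Lemma H_bounded : exists C, forall r, 0 < r < d -> H r <= C.
Proof.
have d0 := d_gt0; have [z0 nz0] :=
  line_in_closure Omega_convex (P + (d / 2)%:C *: X) Y0 Omega_no_line.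
exists (2 * normc z0 + 1) => r rd; rewrite leNgt; apply/negP => Hr.
apply: nz0; apply: subset_closure.
(* [P + (d / 2) X] is the midpoint of [P + r X] and [P + (d - r) X]. *)
have -> : P + (d / 2)%:C *: X + z0 *: Y =
    (1 - 2^-1)%:C *: (P + (d - r)%:C *: X) + (2^-1)%:C *: (pt (0 : R)%:C r + (2 * z0) *: Y).
  rewrite realCB realCB realCM realCV; apply/rowP => j; rewrite !mxE mul0r addr0.
  have -> : (2 : R)%:C = 2 :> R[i] by rewrite (realCD 1 1).
  by field.
apply: (convexP Omega_convex); first lra.
  by apply: pt0_in; lra.
apply: (Hdisc l0 rd Hr).
rewrite normcM -[2]/(1 + 1) -[1 + 1](realCD 1 1) normcR ger0_norm//; lra.
Qed.

Lemma lformX : lform (conjv X) X = 1.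
Proof. by rewrite lformvv X1. Qed.

(** Otherwise a move of modulus [r / |g|] along [Y] would bring height [r] down to 0 and leave the
    half-space of [support]; then [H r / r] would be at most [1 / |g|], with a finite integral over
    the bounded interval. *)
Lemma lformY : lform (conjv X) Y = 0.
Proof.
apply/eqP; apply: contraT => g0; set g := lform _ _ in g0.
have ng : 0 < normc g by rewrite normc_gt0.
have Hr r : 0 < r < d -> H r / r <= (normc g)^-1.
  move=> rd; have /andP[r0 _] := rd; rewrite ler_pdivrMr// leNgt; apply/negP => Hlt.
  pose c := ((normc g)^-1 * r + H r) / 2.
  have c1 : (normc g)^-1 * r < c by rewrite /c; lra.
  have c2 : c < H r by rewrite /c; lra.
  pose z := - (((normc g)^-1 * r / normc g)%:C * g^*%C).
  have zn : normc z = (normc g)^-1 * r.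
    rewrite normcN normcM normc_conj normcR ger0_norm; last first.
      by rewrite divr_ge0 ?mulr_ge0 ?invr_ge0// ltW.
    by rewrite divfK// gt_eqF.
  have := support (Hdisc l0 rd c2 (_ : normc z < c)); rewrite zn => /(_ c1).
  have -> : pt (0 : R)%:C r + z *: Y - P = r%:C *: X + z *: Y.
    by apply/rowP => j; rewrite !mxE; ring.
  have zg : z * g = - r%:C.
    rewrite /z mulNr mulrAC -mulrA mulcJ -realCM; congr (- _%:C); field.
    by rewrite gt_eqF.
  by rewrite lformD !lformZ lformX -/g zg mulr1 subrr ltxx.
exfalso; move: intH; apply/eqP; rewrite lt_eqF//.
apply: le_lt_trans
  (_ : (\int[lebesgue_measure]_(r in `]0%R, d[%classic) cst (normc g)^-1%:E r < _)%E).
  apply: ge0_le_integral.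
  - exact: measurable_itv.
  - move=> r; rewrite /= in_itv/= => rd; rewrite lee_fin divr_ge0 ?H_ge0//.
    by case/andP: rd => /ltW.
  - by apply/measurable_EFinP; exact: measurable_fun_divid.
  - exact: measurable_cst.
  - by move=> r; rewrite /= in_itv/= => rd; rewrite lee_fin Hr.
rewrite integral_cst; last exact: measurable_itv.
have mu : lebesgue_measure [set` `]0 : R, d[] = d%:E.
  by rewrite lebesgue_measure_itv/= lte_fin d_gt0 oppr0 adde0.
rewrite [X in (_ * X)%E](_ : _ = d%:E); last exact: mu.
by rewrite -EFinM ltry.
Qed.

Lemma height z r : lform (conjv X) (pt z r - P) = r%:C.
Proof.
have -> : pt z r - P = z *: Y + r%:C *: X by apply/rowP => j; rewrite !mxE; ring.
by rewrite lformD !lformZ lformX lformY mulr0 add0r mulr1.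
Qed.

Lemma height_lower z w r s : Omega (pt z r) -> Omega (pt w s) -> 0 < r -> 0 < s ->
  2^-1 * ln (s / r) <= k (pt z r) (pt w s).
Proof.
move=> Or Os r0 s0; have := kobayashi_lower connected support Or Os.
by rewrite (height z r) (height w s) !normcR (gtr0_norm r0) (gtr0_norm s0).
Qed.

(** The form separating [u] takes an unknown value on [Y], which cancels from the ratio of the
    moduli. *)
Lemma collinear_lower u z w : ~ closure Omega u -> Omega (u + z *: Y) -> Omega (u + w *: Y) ->
  2^-1 * ln (normc w / normc z) <= k (u + z *: Y) (u + w *: Y).
Proof.
move=> ncu Oz Ow; have [a ha] := separation Omega_convex ncu.
have := kobayashi_lower connected ha Oz Ow.
have E (t : R[i]) : u + t *: Y - u = t *: Y by rewrite addrC addKr.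
rewrite !E !lformZ !normcM -mulf_div mulfV ?mulr1//.
have := ha _ Oz; rewrite E lformZ normc_eq0.
by apply: contraTneq => ->; rewrite mulr0 ltxx.
Qed.

(** Points off the closure are found at height 0, whereas [collinear_lower] compares points of
    [Omega] at a positive height; small vertical shifts reconcile the two. *)
Lemma notin_closure_shift u : ~ closure Omega u ->
  exists2 e, 0 < e & forall r, 0 <= r < e -> ~ closure Omega (u + r%:C *: X).
Proof.
move=> nc; have [|e e0 E] := @open_line R n (~` closure Omega) u X _ nc.
  exact/closed_openC/closed_closure.
exists e; first exact: e0.
move=> r /andP[r0 re]; have rn : normc (r%:C : R[i]) < e by rewrite normcR ger0_norm.
exact: (E _ rn).
Qed.

Lemma horizontal_le x y r : 0 <= x <= l -> 0 <= y <= l -> x <= y -> 0 < r < d ->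
  y - x <= H r / 4 -> k (pt x%:C r) (pt y%:C r) <= 2^-1 * ln 3.
Proof.
move=> xl yl xy rd yx; have ln3 : 0 <= ln (3 : R) by rewrite ln_ge0//; lra.
have [E|nxy] := eqVneq x y.
  rewrite E; apply: le_trans (kobayashi_le (disc_chain_nil (pt_in yl rd))) _.
  by rewrite mulr_ge0.
have xy' : 0 < y - x by rewrite subr_gt0 lt_neqAle nxy.
(* A radius strictly below [H r] and at least twice the length of the move. *)
pose c := H r / 2.
have c0 : 0 < c by rewrite /c; lra.
have cH : c < H r by rewrite /c; lra.
have yxc : normc ((y - x)%:C : R[i]) <= c / 2 by rewrite normcR gtr0_norm// /c; lra.
have c2 : c / 2 < c by lra.
have n0 : normc (0 : R[i]) < c by rewrite normc0.
have := kobayashi_le (affine_disc c0 (fun z => Hdisc xl rd cH (z := z)) n0 (le_lt_trans yxc c2)).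
rewrite scale0r addr0 pt_addY -realCD [x + _]addrC subrK.
move=> le1; apply: le_trans le1 _; rewrite mul0r; apply: poincare0_le.
rewrite normcM normcV [X in _ / X]normcR (gtr0_norm c0) ler_pdivrMr//.
by rewrite mulrC.
Qed.

Lemma vertical_pt_le x r s : 0 <= x <= l -> 0 < r <= s -> s < d ->
  k (pt x%:C r) (pt x%:C s) <= 2^-1 * ln (s / r) + 2^-1 * ln 2.
Proof.
move=> xl rs sd; apply: (vertical_le rs (lexx s)) => z zs.
apply: vertical_disc => //; rewrite sd andbT.
by case/andP: rs => r0; apply: lt_le_trans.
Qed.

Lemma base_le : exists K, forall x r, 0 <= x <= l -> 0 < r <= d / 2 ->
  k (pt x%:C r) (pt (0 : R)%:C (d / 2)) <= 2^-1 * ln (d / 2 / r) + K.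
Proof.
have [d0 l0'] := (d_gt0, l_gt0); have dd : 0 < d / 2 < d by lra.
have ll : 0 <= l <= l by lra.
have [||K HK] := @segment_chain_bound R n Omega Omega_convex (pt (0 : R)%:C (d / 2)) (l%:C *: Y).
- exact: pt_in.
- by rewrite pt_addY add0r; exact: pt_in.
exists (2^-1 * ln 2 + K) => x r xl rd.
have rd' : 0 < r < d by lra.
apply: le_trans (kobayashi_triangle connected (pt_in xl rd') (pt_in xl dd) (pt_in l0 dd)) _.
rewrite addrA lerD//; first by apply: vertical_pt_le => //; lra.
have xl1 : 0 <= x / l <= 1.
  by case/andP: xl => x0 xl'; rewrite divr_ge0 ?(ltW l0')//= ler_pdivrMr// mul1r.
have [c cK] := HK (x / l) 0 xl1 ltac:(lra).
have -> : pt (0 : R)%:C (d / 2) + (x / l)%:C *: (l%:C *: Y) = pt x%:C (d / 2).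
  by rewrite scalerA -realCM divfK ?gt_eqF// pt_addY add0r.
rewrite (scale0r (l%:C *: Y)) addr0 => /kobayashi_le h; exact: le_trans h cK.
Qed.

(** Seen from [o], the path point [x i] is at distance about [D * i], while each step has length at
    most [K1]; so consecutive Gromov products grow like [D * i]. The chain lemma carries this to the
    first and last points of the path, and the vertical ray from the last point back up to height
    [s i0] carries it to [x i0] and [y]. Both are at distance about [D * i0] from [o], so a product
    of that size leaves only a bounded distance between them. *)
Lemma bounded_horizontal_dist : gromov_hyperbolic Omega k ->
  exists M, forall e, 0 < e -> exists r, [/\ 0 < r, r < e, r < d &
    k (pt (0 : R)%:C r) (pt l%:C r) <= M].
Proof.
(* Hyperbolicity persists for a larger constant, and [1 <= D] makes the ratio [q] below at most
   1/2. *)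
move=> [D0 hyp0]; pose D := Num.max D0 1.
have D1 : 1 <= D by rewrite le_max lexx orbT.
have D0D : D0 <= D by rewrite le_max lexx.
have Dge0 : 0 <= D by apply: le_trans D1.
have hyp p u v v' : Omega p -> Omega u -> Omega v -> Omega v' ->
    Num.min (gromov_product k p u v) (gromov_product k p v v') - D <= gromov_product k p u v'.
  by move=> Op Ou Ov Ov'; apply: le_trans (hyp0 p u v v' Op Ou Ov Ov'); rewrite lerB.
have [d0 l0'] := (d_gt0, l_gt0).
(* Lowering the height by the factor [q] costs the distance [- ln q / 2 = D], the growth per step
   that [gromov_product_chain] requires. *)
pose q := expR (- 2 * D).
have q0 : 0 < q := expR_gt0 _.
have q2 : q <= 2^-1.
  rewrite /q mulNr expRN lef_pV2 ?posrE ?expR_gt0//.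
  by apply: le_trans (expR_ge1Dx _); lra.
have q01 : 0 < q < 1 by rewrite q0 (le_lt_trans q2)//; lra.
have lnq : ln q = - 2 * D by rewrite expRK.
have [C HC] := H_bounded.
have [s [sI sdiv]] := divergent_samples d_gt0 q01 mH H_ge0 HC intH.
have a0 i : 0 < d * q ^+ i by rewrite mulr_gt0// exprn_gt0.
have lna i : ln (d * q ^+ i) = ln d - 2 * D * i%:R.
  by rewrite lnM ?posrE ?exprn_gt0// lnXn// lnq -[_ *+ i]mulr_natr; ring.
have s0 i : 0 < s i by case/andP: (sI i) => h _; apply: lt_le_trans h.
have qle i j : (i <= j)%N -> q ^+ j <= q ^+ i.
  by move=> ij; rewrite ler_wiXn2l// ?(ltW q0)//; case/andP: q01 => _ /ltW.
have sd i : 0 < s i < d.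
  rewrite s0/=; case/andP: (sI i) => _ h; apply: lt_le_trans h _.
  by rewrite ler_piMr ?(ltW d0)// -(expr0 q) qle.
have smono i j : (i < j)%N -> s j <= s i.
  move=> ij; case/andP: (sI i) => h1 _; case/andP: (sI j) => _ h2.
  by apply/ltW/(lt_le_trans h2); apply: le_trans h1; rewrite ler_pM2l// qle.
have L1 i : ln d - 2 * D * i%:R - 2 * D <= ln (s i).
  have := lna i.+1; rewrite -natr1 => E.
  have : ln (d * q ^+ i.+1) <= ln (s i) by rewrite ler_ln ?posrE//; case/andP: (sI i).
  rewrite E; lra.
have L2 i : ln (s i) <= ln d - 2 * D * i%:R.
  by rewrite -lna ler_ln ?posrE// ltW//; case/andP: (sI i).
pose rho := d / 2.
have rho0 : 0 < rho by rewrite divr_gt0.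
have rhod : 0 < rho < d by rewrite /rho; lra.
have lnrho : ln rho = ln d - ln 2 by rewrite ln_div ?posrE.
have lndiv x y : 0 < x -> 0 < y -> ln (x / y) = ln x - ln y.
  by move=> x0 y0; rewrite ln_div ?posrE.
have ln2 : 0 <= ln (2 : R) by rewrite ln_ge0//; lra.
have ln3 : 0 <= ln (3 : R) by rewrite ln_ge0//; lra.
pose o := pt (0 : R)%:C rho.
have Oo : Omega o by exact: pt_in.
have [K0 HK0] := base_le.
have lower x r : 0 <= x <= l -> 0 < r < d -> 2^-1 * (ln d - ln 2 - ln r) <= k (pt x%:C r) o.
  move=> xl rd; have /andP[r0 _] := rd.
  rewrite -lnrho -(lndiv _ _ rho0 r0).
  exact: height_lower (pt_in xl rd) Oo r0 rho0.
pose K1 := 2^-1 * ln 3 + 2 * D + 2^-1 * ln 2.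
pose C1 := (ln 2 + K1) / 2.
have K10 : 0 <= K1 by rewrite !addr_ge0// mulr_ge0.
have C10 : 0 <= C1 by rewrite divr_ge0// addr_ge0.
exists (2 * D + 2 * K0 + 2 * (C1 + 2 * D + ln 2)) => e e0.
have [i1 i1e] : exists i1, d * q ^+ i1 < e.
  have ed : 0 < e / d by rewrite divr_gt0.
  have := @cvg_expr R q; rewrite ger0_norm ?(ltW q0)//
    => /(_ ltac:(by case/andP: q01)) /cvgrPdist_lt.
  move=> /(_ _ ed)[i _ /(_ i (leqnn i))].
  rewrite sub0r normrN ger0_norm ?exprn_ge0 ?(ltW q0)// => qn.
  by exists i; rewrite mulrC -ltr_pdivlMr.
(* A positive index, so that [s i0] is at most [d * q], hence at most the height [d / 2] of the base
   point. *)
pose i0 := i1.+1.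
have si0e : s i0 < e.
  case/andP: (sI i0) => _ h; apply: lt_trans i1e; apply: lt_le_trans h _.
  by rewrite ler_pM2l// qle.
have si0rho : s i0 <= rho.
  case/andP: (sI i0) => _ /ltW h; apply: le_trans h _.
  rewrite /rho ler_pM2l//; apply: le_trans q2.
  by rewrite -[leRHS]expr1 qle.
(* Each level allows a move of [H (s i) / 4], whence the factor 4. *)
have [N HN] := sdiv i0 (4 * l).
have i0N : (i0 < N)%N.
  rewrite ltnNge; apply/negP => Ni0; move: HN; rewrite big_geq//; lra.
(* A path drifting from [P] to [P + l Y] while descending: at height [s i] the
   disc in the direction [Y] has radius about [H (s i)], so a move of
   [H (s i) / 4] has bounded Kobayashi length. *)
pose m := fix m i : R := if i is j.+1 then
  if (j < i0)%N then 0 else Num.min l (m j + H (s j) / 4) else 0.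
have Hs i : 0 <= H (s i) by exact: H_ge0.
have m01 i : 0 <= m i <= l.
  elim: i => [|i /andP[m0 ml]] /=; first lra.
  case: ifP => _; first lra.
  by rewrite le_min ge_min lexx/= (ltW l0') addr_ge0// divr_ge0.
have mi0 i : (i <= i0)%N -> m i = 0 by case: i => // i ii0 /=; rewrite ii0.
have mS i : m i <= m i.+1 /\ m i.+1 - m i <= H (s i) / 4.
  case: (ltnP i i0) => ii0.
    by rewrite mi0 ?(ltnW ii0)// mi0// subrr lexx divr_ge0.
  rewrite /= ltnNge ii0/=; have /andP[m0 ml] := m01 i; split.
    by rewrite le_min ml lerDl divr_ge0.
  by rewrite lerBlDr ge_min addrC lexx orbT.
have mN : m N = l.
  have : m N = l \/ (\sum_(i0 <= i < N) H (s i)) / 4 <= m N.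
    elim: (N) (ltnW i0N) => [|j IH].
      by rewrite leqn0 => /eqP.
    rewrite leq_eqVlt => /orP[/eqP <-|ij].
      by right; rewrite big_geq// mul0r; case/andP: (m01 i0).
    rewrite big_nat_recr//= ltnNge (ij : (i0 <= j)%N)/=.
    have /andP[mj0 mjl] := m01 j.
    have Hj : 0 <= H (s j) / 4 by rewrite divr_ge0.
    case: (leP l (m j + H (s j) / 4)) => [|lt]; first by left.
    right; case: (IH ij) => [mjE|le].
      by move: lt; rewrite mjE; lra.
    by rewrite mulrDl lerD2r.
  case=> // le; apply: le_anti; apply/andP; split; first by case/andP: (m01 N).
  by apply: le_trans le; lra.
pose x i := pt (m i)%:C (s i).
have Ox i : Omega (x i) by exact: pt_in.
have step i : k (x i) (x i.+1) <= K1.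
  have [m1 m2] := mS i.
  apply: le_trans (kobayashi_triangle connected (Ox i) (pt_in (m01 i.+1) (sd i)) (Ox i.+1)) _.
  have h1 := horizontal_le (m01 i) (m01 i.+1) m1 (sd i) m2.
  have sS : 0 < s i.+1 <= s i by rewrite s0 smono.
  have [_ sid] := andP (sd i).
  have := vertical_pt_le (m01 i.+1) sS sid.
  rewrite kobayashi_sym (lndiv _ _ (s0 i) (s0 i.+1)) => h2.
  have L1' := L1 i.+1; rewrite -(@natr1 R i) in L1'.
  by rewrite /K1; apply: (step_estimate h1 h2 (L2 i) L1').
have prod i : D * i%:R - C1 <= gromov_product k o (x i) (x i.+1).
  have L2' := L2 i.+1; rewrite -(@natr1 R i) in L2'.
  exact: product_estimate (step i) (lower _ _ (m01 i) (sd i))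
    (lower _ _ (m01 i.+1) (sd i.+1)) (L2 i) L2' Dge0.
have far := gromov_product_chain Dge0 hyp Oo Ox prod (N - i0.+1) i0.
rewrite addnC -addnS subnK// in far.
have ll : 0 <= l <= l by lra.
pose y := pt l%:C (s i0).
have Oy : Omega y by exact: pt_in.
have ray : D * i0%:R - ln 2 <= gromov_product k o (x N) y.
  have sN : 0 < s N <= s i0 by rewrite s0 smono.
  have [_ si0d] := andP (sd i0).
  have v := vertical_pt_le ll sN si0d; rewrite (lndiv _ _ (s0 i0) (s0 N)) in v.
  have b1 := lower _ _ (m01 N) (sd N).
  rewrite /gromov_product /x mN; rewrite mN in b1.
  exact: ray_estimate v b1 (lower _ _ ll (sd i0)) (L2 i0) ln2.
have xy : D * i0%:R - (C1 + 2 * D + ln 2) <= gromov_product k o (x i0) y.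
  exact: chain_estimate ln2 Dge0 C10 far ray (hyp _ _ _ _ Oo (Ox i0) (Ox N) Oy).
have xE : x i0 = pt (0 : R)%:C (s i0) by rewrite /x mi0.
have [_ si0d] := andP (sd i0); exists (s i0); split; [exact: s0|exact: si0e|exact: si0d|].
have s0rho : 0 < s i0 <= rho by rewrite s0.
have b1 := HK0 0 (s i0) l0 s0rho; have b2 := HK0 l (s i0) ll s0rho.
rewrite (lndiv _ _ rho0 (s0 i0)) lnrho in b1 b2; rewrite -xE in b1 *.
exact: final_estimate xy b1 b2 (L1 i0) ln2.
Qed.

(** If [P + z Y] is off the closure, [collinear_lower] at a small height where the points over 0 and
    [l] are at distance at most [M] bounds [|l - z| / |z|] by [expR (2 * M)], and therefore [|z|]
    from below by [l / E]. *)
Lemma boundary_disc : gromov_hyperbolic Omega k ->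
  exists2 e, 0 < e & forall z, normc z < e -> closure Omega (P + z *: Y).
Proof.
move=> /bounded_horizontal_dist[M HM]; have [d0 l0'] := (d_gt0, l_gt0).
have ll : 0 <= l <= l by lra.
pose E := expR (2 * M) + 1.
have E0 : 0 < E by rewrite addr_gt0// expR_gt0.
exists (l / E); first by rewrite divr_gt0.
move=> z zE; apply: contrapT => /notin_closure_shift[e e0 He].
have [r [r0 re rd kM]] := HM e e0.
have nc := He r ltac:(lra).
have e1 : pt (0 : R)%:C r = (P + z *: Y + r%:C *: X) + (- z) *: Y.
  by apply/rowP => j; rewrite !mxE; ring.
have e2 : pt l%:C r = (P + z *: Y + r%:C *: X) + (l%:C - z) *: Y.
  by apply/rowP => j; rewrite !mxE; ring.
have O1 : Omega (pt (0 : R)%:C r) by apply: pt_in => //; lra.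
have O2 : Omega (pt l%:C r) by apply: pt_in => //; lra.
have z0 : 0 < normc z.
  rewrite normc_gt0; apply: contra_notN nc => /eqP z0.
  by apply: subset_closure; rewrite z0; exact: O1.
have := collinear_lower nc; move: O1 O2 kM; rewrite e1 e2 => O1 O2 kM /(_ _ _ O1 O2) low.
have {low} := le_trans low kM; rewrite normcN.
have lz : l - normc z <= normc (l%:C - z).
  by have := le_normcB l%:C z; rewrite normcR gtr0_norm.
have zl : normc z * E < l by rewrite -ltr_pdivlMr.
have lz0 : 0 < l - normc z.
  have : 0 < normc z * expR (2 * M) by rewrite mulr_gt0// expR_gt0.
  by move: zl; rewrite /E mulrDr mulr1; lra.
have {}lz0 := lt_le_trans lz0 lz.
move=> h; have : ln (normc (l%:C - z) / normc z) <= 2 * M by lra.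
rewrite -ler_expR lnK ?posrE ?divr_gt0// ler_pdivrMr//.
by move: zl; rewrite /E; lra.
Qed.

(** The point is the last one of the closure on the ray from [P] towards a point of the line off the
    closure; it differs from [P] because the ray first crosses the disc of radius [e]. *)
Lemma face_boundary_point e : 0 < e -> (forall z, normc z < e -> closure Omega (P + z *: Y)) ->
  exists b : R[i], [/\ b != 0, closure Omega (P + b *: Y) &
    forall t, 1 < t -> ~ closure Omega (P + (t%:C * b) *: Y)].
Proof.
move=> e0 He; have [z0 nz0] := line_in_closure Omega_convex P Y0 Omega_no_line.
pose T := [set t : R | 0 <= t /\ closure Omega (P + (t%:C * z0) *: Y)].
have clP : closure Omega P.
  by have := He 0; rewrite normc0 scale0r addr0; apply.
have z00 : 0 < normc z0.
  rewrite normc_gt0; apply: contra_notN nz0 => /eqP ->.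
  rewrite scale0r addr0; exact: clP.
have T1 t : T t -> t < 1.
  move=> [t0 ct]; rewrite ltNge; apply/negP => t1; apply: nz0.
  have t0' : 0 < t by apply: lt_le_trans t1.
  have tC : t%:C != 0 :> R[i] by rewrite -normc_gt0 normcR normr_gt0 gt_eqF.
  have -> : P + z0 *: Y = (1 - t^-1)%:C *: P + (t^-1)%:C *: (P + (t%:C * z0) *: Y).
    by rewrite realCB realCV; apply/rowP => j; rewrite !mxE; field.
  have ti : 0 <= t^-1 <= 1 by rewrite invr_ge0 t0 invf_le1.
  exact: (closure_convexP Omega_convex ti clP ct).
clear nz0.
have hs : has_sup T.
  split; last by exists 1 => t /T1/ltW.
  exists 0; split; [exact: lexx|rewrite mul0r scale0r addr0; exact: clP].
pose t0 := sup T.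
pose t1 := e / 2 / normc z0.
have t10 : 0 < t1 by rewrite !divr_gt0.
have Tt1 : T t1.
  split; first exact: (ltW t10).
  apply: He; rewrite normcM normcR (gtr0_norm t10) /t1 (divfK (lt0r_neq0 z00)).
  by rewrite ltr_pdivrMr// ltr_pMr//; lra.
have t00 : 0 < t0 := lt_le_trans t10 (ub_le_sup hs.2 Tt1).
exists (t0%:C * z0); split.
- by rewrite -normc_gt0 normcM normcR (gtr0_norm t00) mulr_gt0.
- apply/closure_near => r r0.
  have r2 : 0 < r / 2 by rewrite divr_gt0.
  have L0 : 0 < normc z0 * l1norm Y by rewrite mulr_gt0// l1norm_gt0.
  have [t [tn ct] tt] := sup_adherent (divr_gt0 r2 L0) hs.
  have [u Ou uu] := (closure_near _ _).1 ct _ r2.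
  exists u => // j.
  have tle : t <= t0 by apply: (ub_le_sup hs.2); split.
  have := @near_line R n (P + (t0%:C * z0) *: Y) Y ((t - t0)%:C * z0) (r / 2).
  rewrite normcM normcR ler0_norm ?subr_le0// opprB -mulrA -ltr_pdivlMr//.
  rewrite ltrBlDl -ltrBlDr => /(_ tt j) h.
  rewrite (_ : P + _ + _ = P + (t%:C * z0) *: Y) in h; last first.
    by rewrite realCB; apply/rowP => i; rewrite !mxE; ring.
  rewrite -(subrK ((P + (t%:C * z0) *: Y) ord0 j) (u ord0 j)) -addrA.
  apply: le_lt_trans (le_normcD _ _) _.
  by rewrite (splitr r) ltrD.
- move=> t t_gt1 ct; have : t * t0 <= t0.
    apply: (ub_le_sup hs.2); split; last by rewrite realCM -mulrA.
    by rewrite mulr_ge0 ?(ltW t00) ?(ltW (lt_trans ltr01 t_gt1)).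
  by rewrite leNgt ltr_pMl// t_gt1.
Qed.

(** The admissible size of [z] is independent of the height [r]. With [tau] halfway between [lam]
    and 1, the face point [(t + z) lam b / tau] is a convex combination of [b] and of a point [beta]
    of the disc, the gap [tau - lam] leaving room for [z]; the weight [1 - tau] goes to the point at
    height [r / (1 - tau)] over [P], which lies in [Omega]. *)
Lemma face_shift e b lam z r : 0 < e -> (forall z, normc z < e -> closure Omega (P + z *: Y)) ->
  closure Omega (P + b *: Y) -> b != 0 -> 0 < lam < 1 -> 0 < r < (1 - lam) / 2 * d ->
  forall t, 0 <= t <= 1 -> normc z < (1 - lam) / 2 * e / normc b ->
  Omega (P + ((t%:C + z) * (lam%:C * b)) *: Y + r%:C *: X).
Proof.
move=> e0 He cb b0 /andP[lam0 lam1] /andP[r0 rd] t /andP[t0 t1] zb.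
have nb : 0 < normc b by rewrite normc_gt0.
have [tau tauE] : exists tau : R, tau = (1 + lam) / 2 by exists ((1 + lam) / 2).
have tau1 : tau < 1 by rewrite tauE; lra.
have tau0 : 0 < tau by rewrite tauE; lra.
have tl : lam < tau by rewrite tauE; lra.
have tl' : lam * t <= lam by rewrite ler_piMr// ltW.
have s0 : 0 < tau - lam * t by lra.
have C0 (x : R) : 0 < x -> x%:C != 0 :> R[i].
  by move=> x0; rewrite -normc_gt0 normcR normr_gt0 gt_eqF.
have tau2 : 0 < 1 - tau by rewrite subr_gt0.
have tauC := C0 _ tau0; have sC := C0 _ s0; have rC := C0 _ tau2.
pose beta := z * lam%:C * b / (tau - lam * t)%:C.
have be : normc beta < e.
  rewrite /beta !normcM normcV !normcR (gtr0_norm lam0) (gtr0_norm s0) ltr_pdivrMr//.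
  move: zb; rewrite ltr_pdivlMr// => zb.
  have h1 : normc z * lam * normc b <= normc z * normc b.
    by rewrite mulrAC ler_piMr ?mulr_ge0 ?normc_ge0// ltW.
  apply: le_lt_trans h1 _; apply: lt_le_trans zb _.
  rewrite mulrC ler_pM2l//; rewrite tauE; lra.
have cw : closure Omega (P + (((t%:C + z) * (lam%:C * b)) / tau%:C) *: Y).
  have -> : P + (((t%:C + z) * (lam%:C * b)) / tau%:C) *: Y =
     (1 - lam * t / tau)%:C *: (P + beta *: Y) + (lam * t / tau)%:C *: (P + b *: Y).
    rewrite /beta; move: sC tauC; rewrite !(realCB, realCM, realCV) => sC tauC.
    apply/rowP => j; rewrite !mxE; field.
    by rewrite tauC sC.
  have tt1 : 0 <= lam * t / tau <= 1.
    rewrite divr_ge0 ?mulr_ge0 ?(ltW tau0) ?(ltW lam0)//= (ler_pdivrMr _ _ tau0) mul1r.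
    exact: le_trans tl' (ltW tl).
  exact: (closure_convexP Omega_convex tt1 (He _ be) cb).
have -> : P + ((t%:C + z) * (lam%:C * b)) *: Y + r%:C *: X =
  (1 - tau)%:C *: (P + (r / (1 - tau))%:C *: X) +
  tau%:C *: (P + (((t%:C + z) * (lam%:C * b)) / tau%:C) *: Y).
  move: rC tauC; rewrite !(realCB, realCM, realCV) => rC tauC.
  apply/rowP => j; rewrite !mxE; field.
  by rewrite rC tauC.
have tau01 : 0 <= tau < 1 by rewrite (ltW tau0).
have rtau : 0 < r / (1 - tau) < d.
  rewrite (divr_gt0 r0 tau2)/= (ltr_pdivrMr _ _ tau2) mulrC.
  by move: rd; rewrite tauE; lra.
exact: (convex_closureP Omega_convex tau01 (pt0_in rtau) cw).
Qed.

Lemma no_gromov_hyperbolic : ~ gromov_hyperbolic Omega k.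
Proof.
move=> hypk; have [e e0 He] := boundary_disc hypk.
have [b [b0 cb nb]] := face_boundary_point e0 He.
have [D0 hyp0] := hypk; pose D := Num.max D0 0.
have Dge0 : 0 <= D by rewrite le_max lexx orbT.
have D0D : D0 <= D by rewrite le_max lexx.
have hyp p u v v' : Omega p -> Omega u -> Omega v -> Omega v' ->
    Num.min (gromov_product k p u v) (gromov_product k p v v') - D <= gromov_product k p u v'.
  by move=> Op Ou Ov Ov'; apply: le_trans (hyp0 p u v v' Op Ou Ov Ov'); rewrite lerB.
have [d0 l0'] := (d_gt0, l_gt0).
have ln2 : 0 <= ln (2 : R) by rewrite ln_ge0//; lra.
pose c := 2^-1 * ln (2 : R).
have c0 : 0 <= c by rewrite mulr_ge0.
pose B := 4 * c + 6 * D.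
have B0 : 0 <= B by rewrite /B; lra.
(* The rays over [P] and over the point [lam b] of the face are uniformly
   close, whereas their distance grows without bound as [lam] tends to 1. *)
have [kap [kap0 kap1 kapB]] : exists kap, [/\ 0 < kap, kap <= 2^-1 &
    expR (2 * B) * (2 * kap) = 1].
  exists (expR (- (2 * B)) / 2); split; first by rewrite divr_gt0// expR_gt0.
    have : expR (- (2 * B)) <= expR 0 by rewrite ler_expR oppr_le0 mulr_ge0.
    by rewrite expR0; lra.
  by rewrite expRN; field; rewrite gt_eqF// expR_gt0.
have [lam lamE] : exists lam, lam = 1 - kap by exists (1 - kap).
have lam01 : 0 < lam < 1 by rewrite lamE; lra.
have nb0 : 0 < normc b by rewrite normc_gt0.
pose eta := (1 - lam) / 2 * e / normc b.
have eta0 : 0 < eta by rewrite divr_gt0// mulr_gt0// divr_gt0// lamE subKr.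
pose rho := (1 - lam) / 2 * d.
have rho0 : 0 < rho by rewrite mulr_gt0// divr_gt0// lamE subKr.
have rhod : rho < d by rewrite /rho gtr_pMl// lamE; lra.
have shift := face_shift e0 He cb b0 lam01.
pose Vp r := pt (lam%:C * b) r.
have Vin r : 0 < r < rho -> Omega (Vp r).
  move=> rr; have := shift 0 r rr 1; rewrite normc0 addr0 mul1r; apply => //.
  by rewrite lexx ler01.
pose t0 := - (2^-1) * ln (rho / 2).
(* The height at time [t]: since [2^-1 * ln (h s / h t) = t - s], the rays have unit speed up to the
   additive error [c]. *)
pose h t := expR (- 2 * t).
have h0 t : 0 < h t := expR_gt0 _.
have hrho t : t0 <= t -> 0 < h t < rho.
  move=> tt; rewrite h0/=; apply: le_lt_trans (_ : rho / 2 < _); last lra.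
  by rewrite -[leRHS]lnK ?posrE ?divr_gt0// ler_expR exponent_estimate.
have hd t : t0 <= t -> 0 < h t < d.
  by move=> /hrho/andP[_ hr]; rewrite h0/= (lt_trans hr).
have hle s t : s <= t -> h t <= h s by move=> st; rewrite ler_expR; lra.
have lnh s t : ln (h s / h t) = 2 * (t - s).
  by rewrite ln_div ?posrE// !expRK; lra.
pose U t := pt (0 : R)%:C (h t); pose V t := Vp (h t).
have OU t : t0 <= t -> Omega (U t) by move=> /hd; exact: pt_in.
have OV t : t0 <= t -> Omega (V t) by move=> /hrho; exact: Vin.
(* This disc is the image of the one over [P] with centre height and radius [d / 2], under the
   homothety of ratio [1 - lam] centred at the face point [P + b Y]. *)
have cV z : normc z < rho -> Omega (P + (lam%:C * b) *: Y + (rho%:C + z) *: X).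
  move=> zr; have [lam0 lam1] := andP lam01.
  have kC : kap%:C != 0 :> R[i] by rewrite -normc_gt0 normcR normr_gt0 gt_eqF.
  have lamC : lam%:C = 1 - kap%:C :> R[i] by rewrite lamE realCB.
  have -> : P + (lam%:C * b) *: Y + (rho%:C + z) *: X =
     (1 - lam)%:C *: (P + (0 : R)%:C *: Y + ((d / 2)%:C + z / kap%:C) *: X)
     + lam%:C *: (P + b *: Y).
    have -> : (1 - lam)%:C = kap%:C by rewrite lamE subKr.
    have -> : rho%:C = kap%:C * (d / 2)%:C by rewrite -realCM /rho lamE subKr mulrAC mulrA.
    rewrite lamC; apply/rowP => j; rewrite !mxE; field.
    exact: kC.
  have lam01' : 0 <= lam < 1 by rewrite ltW.
  apply: (convex_closureP Omega_convex lam01' _ cb).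
  apply: (vertical_disc l0); first lra.
  rewrite normcM normcV normcR (gtr0_norm kap0) ltr_pdivrMr//.
  have -> : d / 2 * kap = rho by rewrite /rho lamE; field.
  exact: zr.
clear cb.
have Uray s t : t0 <= s <= t -> k (U s) (U t) <= t - s + c.
  move=> /andP[ts st]; rewrite kobayashi_sym.
  have := @vertical_pt_le 0 (h t) (h s) l0.
  rewrite h0 hle// lnh => /(_ isT ltac:(by case/andP: (hd _ ts))).
  rewrite /U /c; lra.
have Vray s t : t0 <= s <= t -> k (V s) (V t) <= t - s + c.
  move=> /andP[ts st]; rewrite kobayashi_sym.
  have := @vertical_le R n Omega (P + (lam%:C * b) *: Y) X rho (h t) (h s).
  rewrite h0 hle// lnh => /(_ isT ltac:(by case/andP: (hrho _ ts) => _ /ltW) cV).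
  rewrite /V /Vp /c; lra.
have UVge s t : t0 <= s <= t -> t - s <= k (U s) (V t).
  move=> /andP[ts st]; have tt := le_trans ts st.
  rewrite kobayashi_sym.
  by have := height_lower (OV _ tt) (OU _ ts) (h0 _) (h0 _); rewrite lnh; lra.
have VUge s t : t0 <= s <= t -> t - s <= k (V s) (U t).
  move=> /andP[ts st]; have tt := le_trans ts st.
  rewrite kobayashi_sym.
  by have := height_lower (OU _ tt) (OV _ ts) (h0 _) (h0 _); rewrite lnh; lra.
pose N := (Num.truncn (2 / eta)).+1.
have UVb t : t0 <= t -> k (U t) (V t) <= N%:R * (2^-1 * ln 3).
  move=> tt.
  have := @segment_chain R n Omega (U t) ((lam%:C * b) *: Y) eta N 0 1 eta0.
  move=> [||||m mN].
  - move=> s z s01 ze; have := shift z (h t) (hrho _ tt) s s01 ze.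
    rewrite (_ : _ + _ = U t + (s%:C + z) *: ((lam%:C * b) *: Y))//.
    by rewrite /U; apply/rowP => j; rewrite !mxE; ring.
  - by rewrite lexx ler01.
  - by rewrite lexx ler01.
  - have : 2 / eta < N%:R by rewrite truncnS_gt.
    by rewrite ltr_pdivrMr// subr0 normr1; lra.
  move=> /kobayashi_le; rewrite scale0r addr0 scale1r.
  rewrite (_ : U t + _ = V t); first by move=> /le_trans; apply.
  by rewrite /U /V /Vp; apply/rowP => j; rewrite !mxE; ring.
(* The bound [UVb] depends on [lam] through [eta]; the bound obtained here is [B], from which [kap]
   was computed. *)
have close := asymptotic_rays Dge0 (kobayashi_sym Omega) hyp OU OV c0 Uray Vray UVge VUge UVb.
(* The reflection of [lam b] in the end [b] of the face. In units of [|b|] it is at distance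
   [2 - lam] from 0 and [2 * kap] from [lam b], and [(2 - lam) / (2 * kap)] exceeds
   [1 / (2 * kap) = expR (2 * B)]. *)
have nc : ~ closure Omega (P + ((2 - lam)%:C * b) *: Y).
  by apply: nb; rewrite lamE; lra.
have [e1 e10 He1] := notin_closure_shift nc.
have [t tt te] : exists2 t, t0 + `|N%:R * (2^-1 * ln 3)| <= t & - 2^-1 * ln (e1 / 2) <= t.
  exists (Num.max (t0 + `|N%:R * (2^-1 * ln 3)|) (- 2^-1 * ln (e1 / 2))).
    by rewrite le_max lexx.
  by rewrite le_max lexx orbT.
have t0t : t0 <= t by apply: le_trans tt; rewrite lerDl.
have e12 : 0 < e1 / 2 by rewrite divr_gt0.
have e12' : e1 / 2 < e1 by rewrite gtr_pMr// invf_lt1// ltr1n.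
have he : 0 <= h t < e1.
  rewrite (ltW (h0 _))/=; apply: le_lt_trans e12'.
  by rewrite -[leRHS]lnK ?posrE// ler_expR exponent_estimate.
have ncs := He1 _ he.
have EU : U t = (P + ((2 - lam)%:C * b) *: Y + (h t)%:C *: X) + (- ((2 - lam)%:C * b)) *: Y.
  by rewrite /U; apply/rowP => j; rewrite !mxE; ring.
have EV : V t = (P + ((2 - lam)%:C * b) *: Y + (h t)%:C *: X) + (- ((2 - 2 * lam)%:C * b)) *: Y.
  rewrite /V /Vp; apply/rowP => j.
  rewrite (_ : (2 - 2 * lam)%:C = (2 - lam)%:C - lam%:C); first by rewrite !mxE; ring.
  by rewrite -realCB; congr _%:C; ring.
have [OUt OVt] := (OU _ t0t, OV _ t0t).
have ct := close _ tt.
rewrite kobayashi_sym in ct; rewrite EU EV in ct OUt OVt.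
have := le_trans (collinear_lower ncs OVt OUt) ct.
rewrite !normcN !normcM -mulf_div divff ?gt_eqF// mulr1 !normcR.
have a1 : 0 < 2 - lam by rewrite lamE; lra.
have a2 : 2 - 2 * lam = 2 * kap by rewrite lamE; ring.
rewrite a2 !gtr0_norm ?mulr_gt0// -/B => hB.
have : ln ((2 - lam) / (2 * kap)) <= 2 * B by lra.
rewrite -ler_expR lnK ?posrE ?divr_gt0 ?mulr_gt0// ler_pdivrMr ?mulr_gt0//.
rewrite kapB lamE; lra.
Qed.

End boundary_segment.

Theorem theorem20 (R : realType) (n : nat) (Omega S : set 'rV[R[i]]_n)
    (Omega_convex : convex_domain Omega)
    (Omega_no_line : ~ contains_complex_line Omega)
    (S_non_goldilocks : non_goldilocks_segment Omega S) :
  ~ gromov_hyperbolic Omega (kobayashi_dist Omega).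
Proof.
have [[p [q [pq SE]]] Sb _ [d [X [d0 X1 Sin [s [P [Ss SP sP]]]]]]] := S_non_goldilocks.
set Y := (_ *: _); move=> [H [mH H0 Hdir intH]].
(* From here on the piece of [S] from [P] to [s], the two points that define [Y], stands for the
   segment, parametrized by arc length. *)
pose l := enorm (s - P).
have l0 : 0 < l.
  rewrite lt0r sqrtr_ge0 andbT; apply: contra_neq sP => lE.
  by apply/eqP; rewrite -subr_eq0 -sqnorm_eq0 -enorm_sqr -/l lE expr0n.
have lC : l%:C != 0 :> R[i] by rewrite -normc_gt0 normcR normr_gt0 gt_eqF.
have YE : Y = (l^-1)%:C *: (s - P) by [].
have Y0 : Y != 0.
  by rewrite YE scaler_eq0 subr_eq0 (negPf sP) realCV invr_eq0 (negPf lC).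
have SY x : 0 <= x <= l -> S (P + x%:C *: Y).
  move=> /andP[x0 xl]; have x1 : 0 <= x / l <= 1.
    by rewrite divr_ge0 ?(ltW l0)//= ler_pdivrMr// mul1r.
  move: Ss SP; rewrite SE => -[a /= ha aE] [b /= hb Pb].
  rewrite !in_itv/= in ha hb.
  exists ((1 - x / l) * b + x / l * a).
    rewrite /= in_itv/=; case/andP: x1 ha hb => y0 y1 /andP[a0 a1] /andP[b0 b1].
    rewrite addr_ge0 ?(mulr_ge0 y0 a0)//=; last by rewrite mulr_ge0 ?subr_ge0.
    have := ler_wpM2l y0 a1; have := @ler_wpM2l _ (1 - x / l) _ _ _ b1.
    rewrite subr_ge0 => /(_ y1); lra.
  rewrite YE -aE -Pb scalerA -realCM; apply/rowP => j.
  rewrite !mxE !(realCB, realCD, realCM, realCV); field; exact: lC.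
have X1' : sqnorm X = 1 by rewrite -enorm_sqr X1 expr1n.
have [oO _ _] := Omega_convex.
apply: (@no_gromov_hyperbolic R n Omega Omega_convex Omega_no_line P X Y l d H) => //.
- move=> x xl Ox; have [_] := Sb _ (SY x xl); apply.
  by move: Ox; move: oO; rewrite openE => oO /oO.
- move=> x r u xl rd ur; have [Or br er] := Sin _ r (SY x xl) rd.
  rewrite er in br.
  by apply: (ball_in_domain Omega_convex Or _ br ur); case/andP: rd.
- move=> x r c z xl rd cH zc.
  have := Hdir _ r (SY x xl) rd => /(lt_le_trans (_ : (c%:E < (H r)%:E)%E)).
  rewrite lte_fin => /(_ cH) /ereal_sup_gt[_ [r0 [r00 Hr0] <-]].
  rewrite lte_fin => cr0; apply: Hr0; exact: lt_trans cr0.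
Qed.
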